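(* Let $A_{\mathbb{C}}$ be a finite-dimensional complex alternative algebra (unital), equipped with some norm, let $G$ be a domain in $\mathbb{C}$ and let $f_k:G\to A_{\mathbb{C}}$ ($k=1,2,\dots$) be a sequence of holomorphic functions such that $\prod_{k=1}^{+\infty}f_k$ is normally convergent and such that there exist $p\in G$ and an invertible element $c\in A_{\mathbb{C}}^*$ with $$\lim_{n\to+\infty}\prod_{k=1}^nf_k(p)=c.$$ Then there is a holomorphic map $f:G\to A_{\mathbb{C}}$ such that (i) $\lim_{n\to+\infty}\prod_{k=1}^nf_k(z)=f(z)$ locally uniformly on $G$; (ii) for all $z\in G$: $f(z)\in A_{\mathbb{C}}^*$ if and only if $f_k(z)\in A_{\mathbb{C}}^*$ for all $k\in\mathbb{N}$.
   Context: A domain in $\mathbb{C}$ is a connected open subset. An algebra is alternative if $x(xy)=(xx)y$ and $x(yy)=(xy)y$ for all $x,y$. $A_{\mathbb{C}}^*$ denotes the set of invertible elements (in a finite-dimensional alternative algebra left and right invertibility coincide). Finite products are defined by $\prod_{k=1}^0y_k=1$ and $\prod_{k=1}^{n}y_k=\left(\prod_{k=1}^{n-1}y_k\right)y_n$, i.e. bracketed from the left. The product $\prod_{k=1}^{+\infty}f_k$ is normally convergent if every compact subset $K\subset G$ satisfies $\sum_{k=1}^{+\infty}\|f_k-1\|_K<+\infty$, where $\|g\|_K=\sup_{z\in K}\|g(z)\|$ (independent of the choice of norm on $A_{\mathbb{C}}$ since $\dim A_{\mathbb{C}}<\infty$). The norm on $A_{\mathbb{C}}$ is not assumed to be multiplicative.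 *)

(* Defs.v *)
From HB Require Import structures.
From mathcomp Require Import all_boot all_order all_algebra.
From mathcomp Require Import all_classical all_reals all_analysis.
From mathcomp Require Export complex.

Set Implicit Arguments.
Unset Strict Implicit.
Unset Printing Implicit Defensive.

Import Order.TTheory GRing.Theory Num.Theory numFieldNormedType.Exports.

Local Open Scope classical_set_scope.
Local Open Scope ring_scope.

HB.mixin Record Lmodule_isAlternative (K : numFieldType) A & GRing.Lmodule K A := {
  aone : A;
  amul : A -> A -> A;
  amulDl : left_distributive amul +%R;
  amulDr : right_distributive amul +%R;
  ascalerAl : forall (a : K) (x y : A), a *: amul x y = amul (a *: x) y;
  ascalerAr : forall (a : K) (x y : A), a *: amul x y = amul x (a *: y);
  amul1l : left_id aone amul;
  amul1r : right_id aone amul;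
  amulAl : forall x y : A, amul x (amul x y) = amul (amul x x) y;
  amulAr : forall x y : A, amul x (amul y y) = amul (amul x y) y
}.

(* The norm is an arbitrary vector space norm: no compatibility with [amul] or
   [aone] is required. *)
#[short(type="fdNormedAltAlgType")]
HB.structure Definition FdNormedAltAlg (K : numFieldType) :=
  {A of Vector K A & NormedModule K A & Lmodule_isAlternative K A}.

Section AlternativeAlgebra.
Context {K : numFieldType} {A : fdNormedAltAlgType K}.

Definition ainvertible (x : A) : Prop :=
  exists y : A, amul x y = aone /\ amul y x = aone.

(* Sequences are indexed from 0: [y k] is the factor y_{k+1}, and [aprod y n] is
   (..((y_1 y_2) y_3)..) y_n, bracketed from the left. *)
Fixpoint aprod (y : nat -> A) (n : nat) : A :=
  if n is m.+1 then amul (aprod y m) (y m) else aone.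

End AlternativeAlgebra.

(* The copy [R[i]^o] of [R[i]] is the one carrying the usual topology and the
   structure of a normed space over [R[i]]. *)
Notation Cplx R := (R[i]^o).

Section Holomorphic.
Context {R : realType}.

Definition domain (G : set (Cplx R)) : Prop := open G /\ connected G.

(* [derivable f z 1] is the existence of the limit of (f (z + h) - f z) / h as
   the complex number h <> 0 tends to 0. *)
Definition holomorphic_on {V : normedModType R[i]} (G : set (Cplx R))
    (f : Cplx R -> V) : Prop :=
  forall z, G z -> derivable f z 1.

(* Library norms on spaces over [R[i]] take their values in [R[i]]; they are
   nonnegative reals there, hence determined by their real part.
   [sup_norm set0 g] is -oo; [normally_convergent] is then trivially true at
   K = set0, as it should be. *)
Definition sup_norm {V : normedModType R[i]} (K : set (Cplx R))
    (g : Cplx R -> V) : \bar R :=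
  ereal_sup [set (complex.Re `|g z|)%:E | z in K].

Definition normally_convergent {A : fdNormedAltAlgType R[i]}
    (G : set (Cplx R)) (f : nat -> Cplx R -> A) : Prop :=
  forall K : set (Cplx R), compact K -> K `<=` G ->
    (\sum_(0 <= k <oo) sup_norm K (fun z => f k z - aone)%R < +oo)%E.

Definition locally_uniformly_cvg {V : normedModType R[i]} (G : set (Cplx R))
    (F : nat -> Cplx R -> V) (f : Cplx R -> V) : Prop :=
  forall z, G z -> exists2 U : set (Cplx R),
    nbhs z U /\ U `<=` G & {uniform U, F @ \oo --> f}.

End Holomorphic.

(* Main.v *)
From HB Require Import structures.
Require Import Defs.
From mathcomp Require Import all_boot all_order all_algebra.
From mathcomp Require Import all_classical all_reals all_analysis.
From mathcomp Require Import ring lra.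
Import Order.TTheory GRing.Theory Num.Theory.
Import numFieldNormedType.Exports.
Set Implicit Arguments.
Unset Strict Implicit.
Unset Printing Implicit Defensive.
Local Open Scope classical_set_scope.
Local Open Scope ring_scope.

(** The product converges because multiplication in a finite-dimensional algebra
    is bounded, |x y| <= C |x| |y|: the partial products P_n satisfy
    P_(n+1) - P_n = P_n (f_n - 1), so on a compact set where the norms of f_n - 1 are
    summable they are bounded, hence uniformly Cauchy, with a rate that depends on
    these norms only ([small_increments_cauchy], [local_product_cauchy]).
    Boundedness of the multiplication and completeness both come from the
    equivalence of norms, that is from [coordinate_bounded].

    The limit is holomorphic by the convergence theorem of Weierstrass, applied to
    each coordinate ([weierstrass]). Holomorphic means complex differentiable,
    without any continuity of the derivative, so the theorem rests on Goursat's
    bisection argument ([goursat]), for real integrals along the sides of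
    rectangles. It gives the Cauchy estimate |phi'(w)| <= 4 M / r, by comparison of
    the integrals of (phi z - phi w) / (z - w)^2 along a large and along a small
    square; then, by the mean value theorem, a Lipschitz bound for phi in terms of
    its supremum ([holomorphic_lipschitz]). For the differences of a uniformly
    Cauchy sequence this bound is exactly what allows one to exchange the limit with
    the derivative.

    Invertibility is where alternativity enters, through the Moufang identities.
    They yield the cancellation laws x'(x b) = b = (b x) x', the formula
    (x y)^-1 = y^-1 x^-1 ([inverse_pairM]) and, in finite dimension, the fact that the
    factors of an invertible product are invertible ([ainvertible_factors]). If the
    limit F(z) is invertible, so are the nearby P_n(z), and with them all factors
    f_k(z). Conversely, if all f_k(z) are invertible, the elements
    Q_(n+1) = f_n(z)^-1 Q_n are the inverses of the P_n(z); they obey a recursion of the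
    same kind as the P_n(z), hence converge as well, and their limit is an inverse of
    F(z) ([limit_ainvertible]). *)

(** * Alternative algebras: Moufang identities and inverses *)

Section Alternative.
Context {K : numFieldType} {A : fdNormedAltAlgType K}.
Implicit Types x y z a b : A.

Local Notation "x ** y" := (amul x y) (at level 40, left associativity).

Lemma amul0l x : 0 ** x = 0.
Proof. by apply: (addrI (0 ** x)); rewrite -amulDl !addr0. Qed.

Lemma amul0r x : x ** 0 = 0.
Proof. by apply: (addrI (x ** 0)); rewrite -amulDr !addr0. Qed.

Lemma amulNl x y : - x ** y = - (x ** y).
Proof. by apply: (addrI (x ** y)); rewrite -amulDl !subrr amul0l. Qed.

Lemma amulNr x y : x ** - y = - (x ** y).
Proof. by apply: (addrI (x ** y)); rewrite -amulDr !subrr amul0r. Qed.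

Lemma amulBl x y z : (x - y) ** z = x ** z - y ** z.
Proof. by rewrite amulDl amulNl. Qed.

Lemma amulBr x y z : x ** (y - z) = x ** y - x ** z.
Proof. by rewrite amulDr amulNr. Qed.

Definition associator x y z := (x ** y) ** z - x ** (y ** z).

Lemma associator_swap12 x y z : associator y x z = - associator x y z.
Proof.
have e : (x ** y) ** z + (y ** x) ** z = x ** (y ** z) + y ** (x ** z).
  have := amulAl (x + y) z; rewrite !amulDl !amulDr !amulDl -!amulAl => /eqP.
  by rewrite -!addrA (can_eq (addKr _)) !addrA (can_eq (addrK _)) => /eqP <-.
apply/eqP; rewrite -addr_eq0 /associator; apply/eqP.
by rewrite addrC addrACA e -opprD subrr.
Qed.

Lemma associator_swap23 x y z : associator x z y = - associator x y z.
Proof.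
have e : x ** (y ** z) + x ** (z ** y) = (x ** y) ** z + (x ** z) ** y.
  have := amulAr x (y + z); rewrite !amulDl !amulDr !amulDl -!amulAr => /eqP.
  by rewrite -!addrA (can_eq (addKr _)) !addrA (can_eq (addrK _)) => /eqP ->; rewrite addrC.
apply/eqP; rewrite -addr_eq0 /associator; apply/eqP.
by rewrite addrC addrACA -e -opprD subrr.
Qed.

Lemma associator_cycle x y z : associator x y z = associator y z x.
Proof. by rewrite (associator_swap12 y x) (associator_swap23 y z) opprK. Qed.

Lemma amul_flexible x y : (x ** y) ** x = x ** (y ** x).
Proof.
apply/eqP; rewrite -subr_eq0 -/(associator x y x) associator_swap23.
by rewrite /associator amulAl subrr oppr0.
Qed.

(** The difference of the two sides is (xa,x,b) + (x,a,xb). Moving [x] to the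
    front by antisymmetry turns it into - (x,xa,b) - (x,xb,a), which cancels by the
    linearised alternative law for the left factors [x] and [x ** x]. *)
Lemma left_moufang x a b : ((x ** a) ** x) ** b = x ** (a ** (x ** b)).
Proof.
have e1 : associator (x ** a) x b + associator x a (x ** b) =
   ((x ** a) ** x) ** b - x ** (a ** (x ** b)).
  by rewrite /associator addrA subrK.
apply/eqP; rewrite -subr_eq0 -e1 (associator_swap12 x (x ** a)).
rewrite (associator_swap23 x (x ** b)) -opprD oppr_eq0.
rewrite /associator !amulAl -!amulAl.
have e2 u : associator u a b + associator u b a = 0.
  by rewrite [X in _ + X]associator_swap23 subrr.
have := e2 (x ** x); have := congr1 (amul x) (e2 x).
rewrite amul0r amulDr /associator !amulBr -!amulAl => h1 h2.
have /eqP h3 := etrans h2 (esym h1).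
move: h3; rewrite addrACA [in X in _ == X]addrACA (can_eq (addrK _)) => /eqP h3.
by rewrite addrACA -opprD h3 subrr.
Qed.

(** Equivalent to (x,y,zx) = x (y,z,x), which is the left Moufang identity read
    through the antisymmetry of the associator. *)
Lemma middle_moufang x y z : (x ** y) ** (z ** x) = x ** ((y ** z) ** x).
Proof.
have e : associator x y (z ** x) = x ** associator y z x.
  rewrite (associator_swap23 x (z ** x)) (associator_cycle y) /associator.
  by rewrite -amul_flexible left_moufang -amulBr -amulNr opprB.
move: e; rewrite /associator amulBr => /eqP.
by rewrite subr_eq subrK => /eqP.
Qed.

(** [ainvertible] with the inverse as an explicit argument, so that the inverses
    of a sequence of factors can be multiplied together. *)
Definition inverse_pair x y := x ** y = aone /\ y ** x = aone.

Lemma inverse_pair_sym x y : inverse_pair x y -> inverse_pair y x.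
Proof. by case. Qed.

(** By the left Moufang identity x (x'^2 (x b)) = ((x x'^2) x) b = b, so left
    multiplication by [x] is injective; then compare x (x' (x b)) = x b. *)
Lemma inverse_mulKl x x' b : inverse_pair x x' -> x' ** (x ** b) = b.
Proof.
move=> [xx' x'x].
have x_inj u v : x ** u = x ** v -> u = v.
  move=> /(congr1 (fun w => x ** ((x' ** x') ** w))).
  by rewrite -!left_moufang amulAr xx' amul1l x'x !amul1l.
by apply: x_inj; rewrite -left_moufang xx' amul1l.
Qed.

(** Cyclic invariance moves the associator (b,x,x') to (x,x',b), which vanishes
    by [inverse_mulKl]. *)
Lemma inverse_mulKr x x' b : inverse_pair x x' -> (b ** x) ** x' = b.
Proof.
move=> xx'; apply/eqP; rewrite -subr_eq0 -{2}[b]amul1r -xx'.1.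
rewrite -/(associator b x x') (associator_cycle b) /associator.
by rewrite xx'.1 amul1l (inverse_mulKl _ (inverse_pair_sym xx')) subrr.
Qed.

(** The middle Moufang identity (u v) (z u) = u ((v z) u) with z = (v' u') u',
    chosen so that z u = v' u' and v z = u'^2. *)
Lemma inverse_pairM x x' y y' :
  inverse_pair x x' -> inverse_pair y y' -> inverse_pair (x ** y) (y' ** x').
Proof.
have half u u' v v' : inverse_pair u u' -> inverse_pair v v' ->
    (u ** v) ** (v' ** u') = aone.
  move=> uu' vv'.
  have <- : ((v' ** u') ** u') ** u = v' ** u'.
    exact/inverse_mulKr/inverse_pair_sym.
  rewrite middle_moufang -amulAr (inverse_mulKl _ (inverse_pair_sym vv')).
  by rewrite -amulAl uu'.2 amul1r uu'.1.
by move=> xx' yy'; split; apply: half => //; exact: inverse_pair_sym.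
Qed.

(** By flexibility x (y x) = (x y) x = x = x 1. *)
Lemma inverse_pair_intro x y :
  (forall t, x ** t = 0 -> t = 0) -> x ** y = aone -> inverse_pair x y.
Proof.
move=> x_inj xy; split => //; apply/eqP; rewrite -subr_eq0; apply/eqP/x_inj.
by rewrite amulBr -amul_flexible xy amul1l amul1r subrr.
Qed.

Fact amul_is_linear x : linear (amul x).
Proof. by move=> a u v; rewrite amulDr ascalerAr. Qed.

HB.instance Definition _ x := GRing.isLinear.Build K A A _ (amul x)
  (amul_is_linear x).

(** An injective endomorphism of a finite-dimensional space is onto, which
    provides a right inverse. *)
Lemma ainvertible_of_inj x : (forall t, x ** t = 0 -> t = 0) -> ainvertible x.
Proof.
move=> x_inj; pose L : 'End(A) := linfun (amul x).
have kerL : lker L == 0%VS.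
  rewrite -subv0; apply/subvP => t; rewrite memv_ker memv0 lfunE /= => /eqP.
  by move=> /x_inj ->.
exists ((L^-1)%VF aone); apply: inverse_pair_intro => //.
by have := lker0_lfunVK kerL aone; rewrite lfunE.
Qed.

Lemma ainvertibleM x y : ainvertible x -> ainvertible y -> ainvertible (x ** y).
Proof.
by move=> [x' xx'] [y' yy']; exists (y' ** x'); exact: inverse_pairM.
Qed.

(** If y t = 0, the middle Moufang identity gives (x y) (t x) = 0, so t x = 0;
    then (t,x,y) = (y,t,x) = 0 and t (x y) = (t x) y = 0. Both multiplications by
    the invertible element x y are injective. *)
Lemma ainvertible_mul_inj x y : ainvertible (x ** y) ->
  forall t, y ** t = 0 -> t = 0.
Proof.
move=> [w xyw] t yt.
have tx : t ** x = 0.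
  rewrite -[t ** x](inverse_mulKl _ xyw) middle_moufang yt.
  by rewrite amul0l !amul0r.
rewrite -(inverse_mulKr t xyw).
have : associator t x y = 0.
  by rewrite -associator_cycle /associator yt tx amul0l amul0r subrr.
by rewrite /associator tx amul0l sub0r => /eqP; rewrite oppr_eq0 => /eqP ->; rewrite amul0l.
Qed.

Lemma ainvertible_factors x y : ainvertible (x ** y) -> ainvertible x /\ ainvertible y.
Proof.
move=> xy; have iy := ainvertible_of_inj (ainvertible_mul_inj xy); split=> //.
have [y' yy'] := iy; rewrite -(inverse_mulKr x yy').
by apply: ainvertibleM => //; exists y; exact: inverse_pair_sym.
Qed.

End Alternative.

(** * Real-valued norms of vector spaces over the complex numbers *)

Section Modulus.
Context {R : realType} {V : normedModType R[i]}.
Implicit Types x y : V.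

(** The norm of a space over [R[i]] has values in [R[i]]; all estimates are
    carried out on this real number instead. *)
Definition modulus x : R := complex.Re `|x|.

Lemma norm_modulus x : `|x| = (modulus x)%:C%C.
Proof. by rewrite RRe_real // normr_real. Qed.

Lemma modulus_ge0 x : 0 <= modulus x.
Proof. by have := normr_ge0 x; rewrite norm_modulus ler0c. Qed.

Lemma modulus0 : modulus 0 = 0.
Proof. by rewrite /modulus normr0. Qed.

Lemma modulus_eq0 x : modulus x = 0 -> x = 0.
Proof. by move=> x0; apply/normr0_eq0; rewrite norm_modulus x0. Qed.

Lemma modulusD x y : modulus (x + y) <= modulus x + modulus y.
Proof. by have := ler_normD x y; rewrite !norm_modulus -rmorphD lecR. Qed.

Lemma modulusN x : modulus (- x) = modulus x.
Proof. by rewrite /modulus normrN. Qed.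

Lemma modulusB x y : modulus (x - y) = modulus (y - x).
Proof. by rewrite -modulusN opprB. Qed.

Lemma modulus_dist_trans y x z : modulus (x - z) <= modulus (x - y) + modulus (y - z).
Proof. by apply: le_trans (modulusD _ _); rewrite addrA subrK. Qed.

Lemma modulus_le_dist x y : modulus x <= modulus (x - y) + modulus y.
Proof. by have := modulusD (x - y) y; rewrite subrK. Qed.

Lemma modulus_sum (I : Type) (r : seq I) (P : pred I) (F : I -> V) :
  modulus (\sum_(i <- r | P i) F i) <= \sum_(i <- r | P i) modulus (F i).
Proof.
elim/big_ind2 : _ => [|x1 x2 y1 y2 h1 h2|//]; first by rewrite modulus0.
exact: le_trans (modulusD _ _) (lerD h1 h2).
Qed.

Lemma cvg_modulusP T (F : set_system T) {FF : Filter F} (f : T -> V) (l : V) :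
  f @ F --> l <-> forall e : R, 0 < e -> \forall t \near F, modulus (l - f t) < e.
Proof.
split=> [/cvgrPdist_lt h e e0|h].
  have := h e%:C%C; rewrite ltcR => /(_ e0); apply: filterS => t.
  by rewrite norm_modulus ltcR.
apply/cvgrPdist_lt => e e0.
have eE : e = (complex.Re e)%:C%C by rewrite RRe_real // gtr0_real.
rewrite eE ltcR in e0; have := h _ e0; apply: filterS => t.
by rewrite norm_modulus eE ltcR.
Qed.

Lemma nbhs_modulusP x (P : set V) :
  nbhs x P <-> exists2 e : R, 0 < e & forall y, modulus (x - y) < e -> P y.
Proof.
split=> [/nbhs_normP[e /= e0 eP]|[e e0 eP]].
  have eE : e = (complex.Re e)%:C%C by rewrite RRe_real // gtr0_real.
  rewrite eE ltcR in e0; exists (complex.Re e) => // y xy; apply: eP => /=.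
  by rewrite norm_modulus eE ltcR.
apply/nbhs_normP; exists e%:C%C => /=; first by rewrite ltcR.
by move=> y /=; rewrite norm_modulus ltcR => /eP.
Qed.

End Modulus.

Lemma modulusZ {R : realType} {V : normedModType R[i]} (a : R[i]) (x : V) :
  modulus (a *: x) = modulus (a : Cplx R) * modulus x.
Proof.
have := normrZ a x; rewrite norm_modulus (norm_modulus x).
by rewrite (norm_modulus (a : Cplx R)) -rmorphM => /complexI.
Qed.

Section ComplexModulus.
Context {R : realType}.
Implicit Types z w : Cplx R.

Lemma complex_ReB z w : complex.Re (z - w) = complex.Re z - complex.Re w.
Proof. by case: z w => [? ?] [? ?]. Qed.

Lemma complex_ImB z w : complex.Im (z - w) = complex.Im z - complex.Im w.
Proof. by case: z w => [? ?] [? ?]. Qed.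

Lemma complex_ReM z w : complex.Re (z * w) =
  complex.Re z * complex.Re w - complex.Im z * complex.Im w.
Proof. by case: z w => [? ?] [? ?]. Qed.

Lemma complex_ImM z w : complex.Im (z * w) =
  complex.Re z * complex.Im w + complex.Im z * complex.Re w.
Proof. by case: z w => [? ?] [? ?]. Qed.

Lemma modulusE z : modulus z = Num.sqrt (complex.Re z ^+ 2 + complex.Im z ^+ 2).
Proof. by rewrite /modulus normc_def. Qed.

Lemma modulusM z w : modulus (z * w : Cplx R) = modulus z * modulus w.
Proof. exact: modulusZ. Qed.

Lemma modulusV z : modulus (z^-1 : Cplx R) = (modulus z)^-1.
Proof.
have := normfV (z : R[i]); rewrite (norm_modulus (z : Cplx R)) (norm_modulus (z^-1 : Cplx R)).
by rewrite -fmorphV => /complexI.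
Qed.

Lemma modulus_real (r : R) : modulus (r%:C%C : Cplx R) = `|r|.
Proof. by rewrite modulusE /= expr0n /= addr0 sqrtr_sqr. Qed.

Lemma modulus_gt0 z : z != 0 -> 0 < modulus z.
Proof.
move=> z0; rewrite lt_def modulus_ge0 andbT.
by apply: contra z0 => /eqP/modulus_eq0 ->.
Qed.

Lemma ler_Re_modulus z : `|complex.Re z| <= modulus z.
Proof. by have := normc_ge_Re z; rewrite (norm_modulus (z : Cplx R)) lecR. Qed.

Lemma ler_Im_modulus z : `|complex.Im z| <= modulus z.
Proof.
by rewrite modulusE -[X in X <= _]sqrtr_sqr ler_sqrt ?addr_ge0 ?sqr_ge0 // lerDr sqr_ge0.
Qed.

Lemma modulus_le_ReIm z : modulus z <= `|complex.Re z| + `|complex.Im z|.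
Proof.
rewrite modulusE -[leRHS]ger0_norm ?addr_ge0 // -sqrtr_sqr ler_sqrt ?sqr_ge0 //.
rewrite sqrrD !real_normK ?num_real // addrAC.
by rewrite lerDl mulrn_wge0 // mulr_ge0.
Qed.

Lemma complex_complete (u : nat -> Cplx R) (t : nat -> R) :
  (forall e, 0 < e -> exists m, t m < e) ->
  (forall m n, (m <= n)%N -> modulus (u n - u m) <= t m) ->
  cvg (u @ \oo).
Proof.
move=> t0 ut.
have real_part (h : R[i] -> R) : (forall z w, h (z - w) = h z - h w) ->
    (forall z, `|h z| <= modulus (z : Cplx R)) ->
    exists l : R, (fun n => h (u n)) @ \oo --> l.
  move=> hB hm; suff /cvg_ex[l hl] : cvg ((fun n => h (u n)) @ \oo) by exists l.
  apply/cauchy_cvgP/cauchy_exP => e e0.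
  have [m tm] := t0 _ e0; exists (h (u m)).
  exists m => // n /= mn; rewrite -ball_normE /= distrC -hB.
  by rewrite (le_lt_trans (hm _)) // (le_lt_trans _ tm) // ut.
have [a ha] : exists l : R, (fun n => complex.Re (u n)) @ \oo --> l.
  by apply: (real_part (@complex.Re R) _ ler_Re_modulus) => ? ?; rewrite complex_ReB.
have [b hb] : exists l : R, (fun n => complex.Im (u n)) @ \oo --> l.
  by apply: (real_part (@complex.Im R) _ ler_Im_modulus) => ? ?; rewrite complex_ImB.
apply/cvg_ex; exists (Complex a b); apply/cvg_modulusP => e e0.
have e2 : 0 < e / 2 by rewrite divr_gt0.
move/cvgrPdist_lt : ha => /(_ _ e2) ha; move/cvgrPdist_lt : hb => /(_ _ e2) hb.
near=> n; rewrite (le_lt_trans (modulus_le_ReIm _)) // [ltRHS]splitr ltrD //.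
  by rewrite complex_ReB; near: n; exact: ha.
by rewrite complex_ImB; near: n; exact: hb.
Unshelve. all: by end_near. Qed.

End ComplexModulus.

(** * Equivalence of norms and topology of the algebra *)

Section Coordinates.
Context {R : realType} {A : fdNormedAltAlgType R[i]}.
Implicit Types x y : A.

Local Notation dimA := (\dim {: A}%VS).
Local Notation basisA := (vbasis {: A}%VS).

Definition coordinate (i : 'I_dimA) x : Cplx R := coord basisA i x.

Lemma coordinateE x : x = \sum_(i < dimA) coordinate i x *: basisA`_i.
Proof. exact/coord_vbasis/memvf. Qed.

Lemma coordinateB i x y : coordinate i (x - y) = coordinate i x - coordinate i y.
Proof. exact: linearB. Qed.

Lemma coordinateZ i (a : R[i]) x : coordinate i (a *: x) = a * coordinate i x.
Proof. exact: linearZ. Qed.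

Lemma coordinate_comb (a : 'I_dimA -> R[i]) i :
  coordinate i (\sum_j a j *: basisA`_j) = a i.
Proof. by apply: coord_sum_free; exact: (basis_free (vbasisP _)). Qed.

Let complex_of_row (v : 'rV[R]_(dimA + dimA)) (i : 'I_dimA) : R[i] :=
  Complex (v 0 (lshift dimA i)) (v 0 (rshift dimA i)).

Let comb (v : 'rV[R]_(dimA + dimA)) : A :=
  \sum_i complex_of_row v i *: basisA`_i.

Let ler_entry (v : 'rV[R]_(dimA + dimA)) j : `|v 0 j| <= `|v|.
Proof.
by rewrite [leRHS]/Num.norm /= mx_normrE; apply/bigmax_geP; right; exists (0, j).
Qed.

Let modulus_of_row v i : modulus (complex_of_row v i : Cplx R) <= `|v| *+ 2.
Proof. by rewrite (le_trans (modulus_le_ReIm _)) // mulr2n lerD // ler_entry. Qed.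

Let comb_continuous : continuous (fun v => modulus (comb v)).
Proof.
(* The summand 1 only makes the Lipschitz constant [L] positive. *)
pose L := (\sum_(i < dimA) modulus (basisA`_i)) *+ 2 + 1.
have L0 : 0 < L by rewrite ltr_wpDl // mulrn_wge0 // sumr_ge0 // => *; exact: modulus_ge0.
move=> v; apply: (iffRL (cvgrPdist_lt (FF := nbhs_filter v) _ _)) => e e0.
have eL : 0 < e / L by rewrite divr_gt0.
near=> w.
have vw : `|v - w| < e / L by near: w; exact: cvgr_dist_lt.
have h : modulus (comb v - comb w) <= L * `|v - w|.
  rewrite /comb -sumrB (le_trans (modulus_sum _ _ _)) //.
  apply: (@le_trans _ _ (\sum_(i < dimA) (`|v - w| *+ 2 * modulus basisA`_i))).
    apply: ler_sum => i _; rewrite -scalerBl modulusZ ler_wpM2r ?modulus_ge0 //.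
    apply: le_trans (modulus_of_row (v - w) i); rewrite le_eqVlt; apply/orP; left.
    by apply/eqP; congr modulus; rewrite /complex_of_row !mxE.
  by rewrite -mulr_sumr /L [leRHS]mulrDl mul1r !mulrnAl mulrC lerDl.
rewrite (le_lt_trans _ (_ : L * `|v - w| < e)) //; last first.
  by rewrite mulrC -ltr_pdivlMr.
apply: le_trans h; rewrite ler_norml lerBlDr modulus_le_dist andbT.
by rewrite lerNl opprB lerBlDr modulusB modulus_le_dist.
Unshelve. all: by end_near. Qed.

(** On the unit sphere of the real coordinate space, which is compact, the
    modulus of the corresponding linear combination of basis vectors is
    continuous and does not vanish, so it is bounded below. *)
Lemma coordinate_bounded :
  exists2 C : R, 0 < C & forall i x, modulus (coordinate i x) <= C * modulus x.
Proof.
pose S : set 'rV[R]_(dimA + dimA) := [set v | `|v| = 1].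
have cptS : compact S.
  apply: bounded_closed_compact.
    by exists 1; split => // M M1 v /= ->; exact: ltW.
  have -> : S = Num.norm @^-1` [set 1 : R] by [].
  apply: closed_comp; last exact: closed_eq.
  by move=> v _; exact: norm_continuous.
have cpt : compact ((fun v => modulus (comb v)) @` S).
  by apply: continuous_compact cptS; apply: continuous_subspaceT; exact: comb_continuous.
have n0 : ~ ((fun v => modulus (comb v)) @` S) 0.
  move=> [v Sv /modulus_eq0 v0]; have : v = 0.
    have e i : complex_of_row v i = 0.
      by rewrite -(coordinate_comb (complex_of_row v)) -/(comb v) v0 /coordinate linear0.
    apply/rowP => j; rewrite mxE; case: (split_ordP j) => i ->.
      by have := congr1 (@complex.Re R) (e i).
    by have := congr1 (@complex.Im R) (e i).
  by move=> v00; move: Sv; rewrite /S /= v00 normr0 => /eqP; rewrite eq_sym oner_eq0.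
have [d d0 dP] : exists2 d : R, 0 < d & forall v, S v -> d <= modulus (comb v).
  have : open (~` ((fun v => modulus (comb v)) @` S)).
    by apply: closed_openC; apply: compact_closed cpt; exact: Rhausdorff.
  rewrite openE => /(_ _ n0) /nbhs_normP [d /= d0 dP]; exists d => // v Sv.
  rewrite leNgt; apply/negP => lt_d; apply: (dP (modulus (comb v))); last by exists v.
  by rewrite /= sub0r normrN ger0_norm ?modulus_ge0.
exists (2 / d); first by rewrite divr_gt0.
move=> i x.
pose v : 'rV[R]_(dimA + dimA) := row_mx (\row_i complex.Re (coordinate i x))
  (\row_i complex.Im (coordinate i x)).
have vE j : complex_of_row v j = coordinate j x.
  by rewrite /complex_of_row row_mxEl row_mxEr !mxE; case: (coordinate j x).
rewrite -vE (le_trans (modulus_of_row _ _)) //.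
have -> : `|v| *+ 2 = 2 / d * (d * `|v|).
  by rewrite mulrA divfK ?mulr_natl // gt_eqF.
apply: ler_wpM2l; first by rewrite divr_ge0 // ltW.
have [->|v0] := eqVneq v 0; first by rewrite normr0 mulr0 modulus_ge0.
have v0' : 0 < `|v| by rewrite normr_gt0.
rewrite -ler_pdivlMr //.
have Sv : S (`|v|^-1 *: v).
  by rewrite /S /= normrZ normfV normr_id mulVf // gt_eqF.
apply: le_trans (dP _ Sv) _.
have -> : comb (`|v|^-1 *: v) = (`|v|^-1)%:C%C *: x.
  rewrite [in RHS](coordinateE x) scaler_sumr; apply: eq_bigr => j _.
  rewrite scalerA -vE /complex_of_row !mxE; congr (_ *: _).
  by apply/eqP; rewrite eq_complex /= !mul0r subr0 addr0 !eqxx.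
by rewrite modulusZ modulus_real normfV normr_id mulrC.
Qed.

End Coordinates.

Section AlgebraTopology.
Context {R : realType} {A : fdNormedAltAlgType R[i]}.
Implicit Types x y : A.

Local Notation dimA := (\dim {: A}%VS).
Local Notation basisA := (vbasis {: A}%VS).

Lemma amul_suml (I : Type) (r : seq I) (P : pred I) (a : I -> R[i]) (F : I -> A) y :
  amul (\sum_(i <- r | P i) a i *: F i) y = \sum_(i <- r | P i) a i *: amul (F i) y.
Proof.
elim/big_rec2 : _ => [|i u v _ <-]; first exact: amul0l.
by rewrite amulDl ascalerAl.
Qed.

Lemma amul_bounded : exists2 C : R, 0 < C &
  forall x y, modulus (amul x y) <= C * modulus x * modulus y.
Proof.
have [C0 C00 hC0] := @coordinate_bounded R A.
pose M := \sum_(i < dimA) \sum_(j < dimA) modulus (amul basisA`_i basisA`_j).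
have M0 : 0 <= M by do 2 (apply: sumr_ge0 => ? _); exact: modulus_ge0.
exists (C0 * C0 * M + 1) => [|x y]; first by rewrite ltr_wpDl // !mulr_ge0 // ltW.
apply: (@le_trans _ _ (C0 * C0 * M * modulus x * modulus y)); last first.
  by rewrite -!mulrA [leRHS]mulrDl !mulrA mul1r lerDl mulr_ge0 ?modulus_ge0.
rewrite {1}(coordinateE x) amul_suml (le_trans (modulus_sum _ _ _)) //.
have -> : C0 * C0 * M * modulus x * modulus y =
    C0 * modulus x * (C0 * modulus y) * M by ring.
rewrite mulr_sumr; apply: ler_sum => i _.
rewrite modulusZ -mulrA; apply: ler_pM; rewrite ?modulus_ge0 ?hC0 //.
rewrite {1}(coordinateE y) linear_sum (le_trans (modulus_sum _ _ _)) //.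
rewrite mulr_sumr; apply: ler_sum => j _.
by rewrite linearZ modulusZ ler_wpM2r ?modulus_ge0 ?hC0.
Qed.

Lemma amul_cvg T (F : set_system T) {FF : Filter F} (u v : T -> A) (a b : A) :
  u @ F --> a -> v @ F --> b -> (fun t => amul (u t) (v t)) @ F --> amul a b.
Proof.
have [C C0 hC] := amul_bounded.
move=> /cvg_modulusP hu /cvg_modulusP hv; apply/cvg_modulusP => e e0.
pose M := C * (modulus a + modulus b + 1).
have M0 : 0 < M by rewrite mulr_gt0 // ltr_wpDl // addr_ge0 // modulus_ge0.
pose d := Num.min 1 (e / (2 * M)).
have d0 : 0 < d by rewrite lt_min ltr01 divr_gt0 // mulr_gt0.
near=> t.
have ht : modulus (a - u t) < d by near: t; exact: hu.
have kt : modulus (b - v t) < d by near: t; exact: hv.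
have -> : amul a b - amul (u t) (v t) = amul (a - u t) (v t) + amul a (b - v t).
  by rewrite amulBl amulBr [RHS]addrC addrA subrK.
have vt : modulus (v t) <= modulus b + 1.
  rewrite (le_trans (modulus_le_dist _ b)) // addrC lerD2l modulusB ltW //.
  by rewrite (lt_le_trans kt) // ge_min lexx.
have := hC (a - u t) (v t); have := hC a (b - v t); have := modulus_ge0 a.
have := modulus_ge0 b; have := modulus_ge0 (v t).
have dM : 2 * M * d <= e.
  rewrite mulrC -ler_pdivlMr; last exact: mulr_gt0.
  by rewrite ge_min lexx orbT.
have := modulusD (amul (a - u t) (v t)) (amul a (b - v t)).
set X := modulus (_ + _); set X1 := modulus (amul (a - u t) _); set X2 := modulus (amul a _).
move=> h1 v0 b0 a0 h2 h3.
have h4 : X2 <= C * modulus a * d.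
  rewrite (le_trans h2) //; apply: ler_wpM2l; last exact: ltW.
  by rewrite mulr_ge0 // ltW.
have h5 : X1 <= C * d * (modulus b + 1).
  rewrite (le_trans h3) //; apply: ler_pM; rewrite ?mulr_ge0 ?modulus_ge0 // ?(ltW C0) //.
  by rewrite ler_pM2l // ltW.
have h6 : X1 + X2 <= M * d.
  by rewrite (le_trans (lerD h5 h4)) // /M le_eqVlt; apply/orP; left; apply/eqP; ring.
have : 0 < M * d by rewrite mulr_gt0.
by move: dM; rewrite -mulrA; lra.
Unshelve. all: by end_near. Qed.

Lemma cvg_coordinate T (F : set_system T) {FF : Filter F} (u : T -> A) (l : A) :
  (forall i, (fun t => coordinate i (u t)) @ F --> coordinate i l) -> u @ F --> l.
Proof.
move=> h; rewrite (coordinateE l).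
rewrite (_ : u = fun t => \sum_(i < dimA) coordinate i (u t) *: basisA`_i); last first.
  by apply/funext => t; exact: coordinateE.
apply: cvg_big => [|i _]; first exact: add_continuous.
by apply: cvgZr_tmp; exact: h.
Qed.

Lemma coordinate_cvg T (F : set_system T) {FF : Filter F} (u : T -> A) (l : A) i :
  u @ F --> l -> (fun t => coordinate i (u t)) @ F --> coordinate i l.
Proof.
have [C C0 hC] := @coordinate_bounded R A.
move=> /cvg_modulusP hu; apply/cvg_modulusP => e e0.
have := hu (e / C); rewrite divr_gt0 // => /(_ isT); apply: filterS => t.
rewrite ltr_pdivlMr // mulrC => ht; rewrite -coordinateB.
exact: le_lt_trans (hC _ _) ht.
Qed.

Lemma algebra_complete (u : nat -> A) (t : nat -> R) :
  (forall e, 0 < e -> exists m, t m < e) ->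
  (forall m n, (m <= n)%N -> modulus (u n - u m) <= t m) ->
  cvg (u @ \oo).
Proof.
move=> t0 ut; have [C C0 hC] := @coordinate_bounded R A.
have /choice[l hl] i : exists l : Cplx R, (fun n => coordinate i (u n)) @ \oo --> l.
  suff /cvg_ex[l hl] : cvg ((fun n => coordinate i (u n)) @ \oo) by exists l.
  apply: (@complex_complete _ _ (fun m => C * t m)) => [e e0|m n mn].
    have [m hm] := t0 (e / C) (divr_gt0 e0 C0).
    by exists m; rewrite mulrC -ltr_pdivlMr.
  by rewrite -coordinateB (le_trans (hC _ _)) // ler_pM2l // ut.
apply/cvg_ex; exists (\sum_(i < dimA) l i *: basisA`_i); apply: cvg_coordinate => i.
by rewrite coordinate_comb; exact: hl.
Qed.

(** If x t = 0 then t = - (x - 1) t, which is shorter than [t] unless t = 0. *)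
Lemma ainvertible_near1 : exists2 d : R, 0 < d &
  forall x, modulus (x - aone) < d -> ainvertible x.
Proof.
have [C C0 hC] := amul_bounded.
exists C^-1; rewrite ?invr_gt0 // => x x1; apply: ainvertible_of_inj => t xt.
apply: modulus_eq0; have := hC (x - aone) t.
rewrite amulBl xt amul1l sub0r modulusN => ht.
have k : C * modulus (x - aone) < 1 by rewrite mulrC -ltr_pdivlMr // mul1r.
have := modulus_ge0 t; rewrite le_eqVlt => /orP[/eqP <- //|t0].
by move: ht; rewrite leNgt -{2}[modulus t]mul1r ltr_pM2r // k.
Qed.

Lemma derivable_coordinate (f : Cplx R -> A) z :
  derivable f z 1 <-> forall i, derivable (fun w => coordinate i (f w) : Cplx R) z 1.
Proof.
have E i : (fun k : Cplx R => coordinate i (k^-1 *: (f (k *: 1 + z) - f z))) =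
    (fun k => k^-1 *: (coordinate i (f (k *: 1 + z)) - coordinate i (f z))).
  by apply/funext => k; rewrite coordinateZ coordinateB.
split=> [/cvg_ex[l hl] i|h].
  by apply/cvg_ex; exists (coordinate i l); have := coordinate_cvg (i := i) hl; rewrite E; exact.
have /choice[l hl] i : exists l : Cplx R,
    (fun k : Cplx R => k^-1 *: (coordinate i (f (k *: 1 + z)) - coordinate i (f z))) @ 0^' --> l.
  by have /cvg_ex[l hl] := h i; exists l.
apply/cvg_ex; exists (\sum_(i < dimA) l i *: basisA`_i); apply: cvg_coordinate => i.
by rewrite coordinate_comb; have := hl i; rewrite -E; exact.
Qed.

End AlgebraTopology.

(** * Goursat's theorem for rectangles *)

Section SegmentIntegral.
Context {R : realType}.
Local Notation mu := (@lebesgue_measure R).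
Implicit Types (h k : R -> R) (a b m : R).

Definition segment_integral h a b : R := \int[mu]_(x in `[a, b]) h x.

Definition segment_continuous h a b :=
  forall x, a <= x <= b -> {for x, continuous h}.

Lemma segment_integrable h a b : segment_continuous h a b ->
  mu.-integrable `[a, b] (EFin \o h).
Proof.
move=> hc; apply: continuous_compact_integrable; first exact: segment_compact.
apply: continuous_in_subspaceT => x; rewrite inE /= in_itv /= => xab.
exact: hc.
Qed.

Lemma segment_integral_cst (r : R) a b : a <= b -> segment_integral (fun=> r) a b = r * (b - a).
Proof.
move=> ab; rewrite /segment_integral Rintegral_cst //=.
by rewrite lebesgue_measure_itv /= lte_fin; case: ltgtP ab => //= ->; rewrite subrr.
Qed.

Lemma segment_integral_le h a b r : a <= b -> segment_continuous h a b ->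
  (forall x, a <= x <= b -> h x <= r) -> segment_integral h a b <= r * (b - a).
Proof.
move=> ab hc hr; rewrite -(segment_integral_cst r ab); apply: le_Rintegral => //.
- exact: segment_integrable.
- by apply: segment_integrable => x _; exact: cst_continuous.
Qed.

Lemma segment_integral_ge h a b r : a <= b -> segment_continuous h a b ->
  (forall x, a <= x <= b -> r <= h x) -> r * (b - a) <= segment_integral h a b.
Proof.
move=> ab hc hr; rewrite -(segment_integral_cst r ab); apply: le_Rintegral => //.
- by apply: segment_integrable => x _; exact: cst_continuous.
- exact: segment_integrable.
Qed.

Lemma segment_integral_dist h a b r e : a <= b -> segment_continuous h a b ->
  (forall x, a <= x <= b -> `|h x - r| <= e) ->
  `|segment_integral h a b - r * (b - a)| <= e * (b - a).
Proof.
move=> ab hc hr; rewrite ler_norml !lerBlDr lerBrDr -mulNr -!mulrDl; apply/andP; split.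
  by apply: segment_integral_ge => // x /hr; rewrite ler_norml lerBrDr => /andP[].
by apply: segment_integral_le => // x /hr; rewrite ler_norml lerBlDr => /andP[].
Qed.

Lemma segment_integralD h k a b :
  segment_continuous h a b -> segment_continuous k a b ->
  segment_integral (fun x => h x + k x) a b =
  segment_integral h a b + segment_integral k a b.
Proof. by move=> hc kc; apply: RintegralD => //; exact: segment_integrable. Qed.

Lemma segment_integral_split h m a b : a <= m <= b -> segment_continuous h a b ->
  segment_integral h a b = segment_integral h a m + segment_integral h m b.
Proof.
move=> /andP[am mb] hc.
have := @Rintegral_itvB R h (BLeft a) (BRight b) m (segment_integrable hc).
rewrite !bnd_simp => /(_ am mb); rewrite Rintegral_itv_obnd_cbnd; last first.
  apply: integrableS (segment_integrable hc) => //.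
  by apply: subset_itvr; rewrite bnd_simp.
by rewrite /segment_integral => <-; rewrite addrC subrK.
Qed.

End SegmentIntegral.

Section ComplexDerivative.
Context {R : realType}.
Implicit Types (g : Cplx R -> Cplx R) (z w l : Cplx R).

(** The remainder form avoids dividing by w - z and includes w = z. *)
Definition has_derivative g z l := forall e : R, 0 < e -> exists2 d : R, 0 < d &
  forall w, modulus (w - z) < d -> modulus (g w - g z - l * (w - z)) <= e * modulus (w - z).

Lemma derivableP_modulus g z : derivable g z 1 <-> exists l, has_derivative g z l.
Proof.
split=> [/cvg_ex[l /cvg_modulusP hl]|[l hl]].
  exists l => e e0; have := hl e e0; rewrite near_withinE.
  move=> /nbhs_modulusP[d d0 hd]; exists d => // w wz.
  have [->|w0] := eqVneq w z; first by rewrite !subrr mulr0 subrr modulus0 mulr0.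
  have w0' : w - z != 0 by rewrite subr_eq0.
  have := hd (w - z); rewrite sub0r modulusN => /(_ wz w0').
  rewrite /= scaler1 subrK => h.
  have -> : g w - g z - l * (w - z) = - (l - (w - z)^-1 * (g w - g z)) * (w - z).
    by rewrite mulNr mulrBl mulrAC mulVf // mul1r opprB.
  by rewrite modulusM modulusN ler_wpM2r ?modulus_ge0 // ltW.
apply/cvg_ex; exists l; apply/cvg_modulusP => e e0; rewrite near_withinE.
have e2 : 0 < e / 2 by rewrite divr_gt0.
have [d d0 hd] := hl _ e2; apply/nbhs_modulusP; exists d => // h.
rewrite sub0r modulusN => hh h0 /=.
have := hd (h + z); rewrite addrK scaler1 => /(_ hh) k.
have -> : l - h^-1 *: (g (h + z) - g z) = - (h^-1 * (g (h + z) - g z - l * h)).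
  by rewrite mulrBr mulrCA mulVf // mulr1 opprB.
rewrite modulusN modulusM modulusV mulrC ltr_pdivrMr ?modulus_gt0 //.
rewrite (le_lt_trans k) // ltr_pM2r ?modulus_gt0 //.
by rewrite ltr_pdivrMr // ltr_pMr // ltr1n.
Qed.

Lemma continuous_modulusP (V W : normedModType R[i]) (f : V -> W) x :
  {for x, continuous f} <-> forall e : R, 0 < e -> exists2 d : R, 0 < d &
    forall y, modulus (x - y) < d -> modulus (f x - f y) < e.
Proof.
split=> [/(iffLR (cvg_modulusP (FF := nbhs_filter x) _ _)) h e /h /nbhs_modulusP //|h].
apply: (iffRL (cvg_modulusP (FF := nbhs_filter x) _ _)) => e /h; exact: (iffRL (nbhs_modulusP _ _)).
Qed.

Lemma has_derivative_continuous g z l : has_derivative g z l -> {for z, continuous g}.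
Proof.
move=> hl; apply/continuous_modulusP => e e0; have [d d0 hd] := hl 1 ltr01.
have K0 : 0 < 1 + modulus l by rewrite ltr_pwDl // modulus_ge0.
exists (Num.min d (e / (1 + modulus l))).
  by rewrite lt_min d0 divr_gt0.
move=> w; rewrite lt_min modulusB => /andP[wd]; rewrite ltr_pdivlMr // => we.
rewrite modulusB (le_lt_trans _ we) // (le_trans (modulus_le_dist _ (l * (w - z)))) //.
rewrite modulusM [leRHS]mulrC mulrDl mul1r; apply: lerD => //.
by have := hd w wd; rewrite mul1r.
Qed.

Lemma derivable_cplx_continuous g z : derivable g z 1 -> {for z, continuous g}.
Proof. by move=> /derivableP_modulus[l]; exact: has_derivative_continuous. Qed.

End ComplexDerivative.

Section Contour.
Context {R : realType}.
Implicit Types (g : Cplx R -> Cplx R) (a b c d m : R).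

(** The real part of the integral of [g] along the positively oriented boundary
    of the rectangle with opposite corners a + ic and b + id. Opposite sides are
    grouped, so that constants cancel under each integral. *)
Definition contour_integral g a b c d : R :=
  segment_integral (fun x => complex.Re (g (Complex x c)) - complex.Re (g (Complex x d))) a b -
  segment_integral (fun y => complex.Im (g (Complex b y)) - complex.Im (g (Complex a y))) c d.

Definition continuous_hedge g a b c :=
  forall x, a <= x <= b -> {for Complex x c : Cplx R, continuous g}.
Definition continuous_vedge g a c d :=
  forall y, c <= y <= d -> {for Complex a y : Cplx R, continuous g}.

Lemma Re_edge_continuous g a b c : continuous_hedge g a b c ->
  segment_continuous (fun x => complex.Re (g (Complex x c))) a b.
Proof.
move=> hg x /hg /continuous_modulusP gx.
apply: (iffRL (cvgrPdist_lt (FF := nbhs_filter x) _ _)) => e /gx[d d0 hd].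
apply/nbhs_normP; exists d => //= y xy.
rewrite -complex_ReB (le_lt_trans (ler_Re_modulus _)) // hd //.
rewrite (le_lt_trans (modulus_le_ReIm _)) // complex_ReB complex_ImB /=.
by rewrite subrr normr0 addr0.
Qed.

Lemma Im_edge_continuous g a c d : continuous_vedge g a c d ->
  segment_continuous (fun y => complex.Im (g (Complex a y))) c d.
Proof.
move=> hg x /hg /continuous_modulusP gx.
apply: (iffRL (cvgrPdist_lt (FF := nbhs_filter x) _ _)) => e /gx[r r0 hd].
apply/nbhs_normP; exists r => //= y xy.
rewrite -complex_ImB (le_lt_trans (ler_Im_modulus _)) // hd //.
rewrite (le_lt_trans (modulus_le_ReIm _)) // complex_ReB complex_ImB /=.
by rewrite subrr normr0 add0r.
Qed.

Lemma segment_continuousB (h k : R -> R) a b : segment_continuous h a b ->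
  segment_continuous k a b -> segment_continuous (fun x => h x - k x) a b.
Proof. by move=> hh hk x xab; apply: cvgB; [exact: hh|exact: hk]. Qed.

Lemma contour_integral_vsplit g m a b c d : a <= m <= b ->
  continuous_hedge g a b c -> continuous_hedge g a b d ->
  continuous_vedge g a c d -> continuous_vedge g m c d -> continuous_vedge g b c d ->
  contour_integral g a b c d = contour_integral g a m c d + contour_integral g m b c d.
Proof.
move=> amb hc hd va vm vb; rewrite /contour_integral.
rewrite (segment_integral_split amb); last first.
  by apply: segment_continuousB; exact: Re_edge_continuous.
rewrite addrACA -opprD -segment_integralD; last 2 first.
- by apply: segment_continuousB; exact: Im_edge_continuous.
- by apply: segment_continuousB; exact: Im_edge_continuous.
congr (_ - _); congr segment_integral; apply/funext => y.
by rewrite [RHS]addrC addrA subrK.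
Qed.

Lemma contour_integral_hsplit g m a b c d : c <= m <= d ->
  continuous_hedge g a b c -> continuous_hedge g a b m -> continuous_hedge g a b d ->
  continuous_vedge g a c d -> continuous_vedge g b c d ->
  contour_integral g a b c d = contour_integral g a b c m + contour_integral g a b m d.
Proof.
move=> cmd hc hm hd va vb; rewrite /contour_integral.
rewrite (segment_integral_split cmd); last first.
  by apply: segment_continuousB; exact: Im_edge_continuous.
rewrite addrACA -opprD -segment_integralD; last 2 first.
- by apply: segment_continuousB; exact: Re_edge_continuous.
- by apply: segment_continuousB; exact: Re_edge_continuous.
congr (_ - _); congr segment_integral; apply/funext => y.
by rewrite addrA subrK.
Qed.

(** The affine part of [g] contributes Im l (b - a) (d - c) to both integrals,
    hence nothing to their difference; only the remainder is left. *)
Lemma contour_integral_local g z l e a b c d : 0 <= e -> a <= b -> c <= d ->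
  continuous_hedge g a b c -> continuous_hedge g a b d ->
  continuous_vedge g a c d -> continuous_vedge g b c d ->
  a <= complex.Re z <= b -> c <= complex.Im z <= d ->
  (forall w, a <= complex.Re w <= b -> c <= complex.Im w <= d ->
     modulus (g w - g z - l * (w - z) : Cplx R) <= e * modulus (w - z : Cplx R)) ->
  `|contour_integral g a b c d| <= 2 * e * ((b - a) + (d - c)) ^+ 2.
Proof.
move=> e0 ab cd hc hd va vb za zc hz; set L := (b - a) + (d - c).
have near_affine w : a <= complex.Re w <= b -> c <= complex.Im w <= d ->
    modulus (g w - g z - l * (w - z) : Cplx R) <= e * L.
  move=> wa wc; rewrite (le_trans (hz w wa wc)) // ler_wpM2l //.
  rewrite (le_trans (modulus_le_ReIm _)) // complex_ReB complex_ImB /L.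
  move: za zc wa wc; move: (complex.Re z) (complex.Im z) (complex.Re w) (complex.Im w).
  move=> p q r s /andP[? ?] /andP[? ?] /andP[? ?] /andP[? ?].
  by rewrite lerD // ler_norml; apply/andP; split; lra.
have diff w1 w2 : a <= complex.Re w1 <= b -> c <= complex.Im w1 <= d ->
    a <= complex.Re w2 <= b -> c <= complex.Im w2 <= d ->
    modulus (g w1 - g w2 - l * (w1 - w2) : Cplx R) <= 2 * e * L.
  move=> h1 h2 h3 h4; have k1 := near_affine _ h1 h2; have k2 := near_affine _ h3 h4.
  have -> : g w1 - g w2 - l * (w1 - w2) =
     (g w1 - g z - l * (w1 - z)) - (g w2 - g z - l * (w2 - z)) by ring.
  rewrite (le_trans (modulusD _ _)) // modulusN.
  by rewrite -mulrA mulr_natl mulr2n lerD.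
have Hx : `|segment_integral
    (fun x => complex.Re (g (Complex x c)) - complex.Re (g (Complex x d))) a b
    - complex.Im l * (d - c) * (b - a)| <= 2 * e * L * (b - a).
  apply: segment_integral_dist => //.
    by apply: segment_continuousB; exact: Re_edge_continuous.
  move=> x xab; rewrite -complex_ReB.
  have -> : complex.Im l * (d - c) = complex.Re (l * (Complex x c - Complex x d)).
    by rewrite complex_ReM complex_ReB complex_ImB /=; ring.
  rewrite -complex_ReB (le_trans (ler_Re_modulus _)) //.
  by apply: diff; rewrite //= ?lexx ?cd.
have Hy : `|segment_integral
    (fun y => complex.Im (g (Complex b y)) - complex.Im (g (Complex a y))) c d
    - complex.Im l * (b - a) * (d - c)| <= 2 * e * L * (d - c).
  apply: segment_integral_dist => //.
    by apply: segment_continuousB; exact: Im_edge_continuous.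
  move=> y ycd; rewrite -complex_ImB.
  have -> : complex.Im l * (b - a) = complex.Im (l * (Complex b y - Complex a y)).
    by rewrite complex_ImM complex_ReB complex_ImB /=; ring.
  rewrite -complex_ImB (le_trans (ler_Im_modulus _)) //.
  by apply: diff; rewrite //= ?lexx ?ab.
rewrite /contour_integral; move: Hx Hy.
set I1 := segment_integral _ _ _; set I2 := segment_integral _ _ _ => Hx Hy.
have -> : I1 - I2 = (I1 - complex.Im l * (d - c) * (b - a)) -
   (I2 - complex.Im l * (b - a) * (d - c)) by ring.
rewrite (le_trans (ler_normB _ _)) // (le_trans (lerD Hx Hy)) //.
by rewrite -mulrDr -/L -[leLHS]mulrA -expr2.
Qed.

End Contour.

Section Goursat.
Context {R : realType}.
Implicit Types (g : Cplx R -> Cplx R) (a b c d m : R).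

Lemma nested_intervals (u v : nat -> R) :
  (forall n, u n <= u n.+1 <= v n.+1) -> (forall n, v n.+1 <= v n) -> u 0%N <= v 0%N ->
  exists x, forall n, u n <= x <= v n.
Proof.
move=> uS vS uv0.
have uv n : u n <= v n by case: n => // n; case/andP: (uS n).
have uD n k : u n <= u (n + k)%N.
  elim: k => [|k IH]; first by rewrite addn0.
  by rewrite addnS (le_trans IH) //; case/andP: (uS (n + k)%N).
have vD n k : v (n + k)%N <= v n.
  by elim: k => [|k IH]; [rewrite addn0 | rewrite addnS (le_trans (vS _))].
have ub (m : nat) : ubound (range u) (v m).
  move=> _ [n _ <-]; rewrite (le_trans (uD n m)) // (le_trans (uv _)) //.
  by rewrite addnC vD.
have us : has_sup (range u) by split; [exists (u 0%N), 0%N|exists (v 0%N)].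
exists (sup (range u)) => n; apply/andP; split.
  by apply: sup_upper_bound => //; exists n.
by apply: ge_sup (ub n); case: us.
Qed.

(** Otherwise every bad rectangle has a bad quarter, and the nested bad
    rectangles shrink to a point, near which [P] holds. *)
Lemma rectangle_bisection (P : R -> R -> R -> R -> Prop) a b c d : a <= b -> c <= d ->
  (forall a' b' c' d', a <= a' -> a' <= b' -> b' <= b -> c <= c' -> c' <= d' -> d' <= d ->
     let p := (a' + b') / 2 in let q := (c' + d') / 2 in
     P a' p c' q -> P a' p q d' -> P p b' c' q -> P p b' q d' -> P a' b' c' d') ->
  (forall x y, a <= x <= b -> c <= y <= d -> exists2 r : R, 0 < r &
     forall a' b' c' d', a <= a' -> b' <= b -> c <= c' -> d' <= d ->
       a' <= x <= b' -> c' <= y <= d' -> (b' - a') + (d' - c') < r -> P a' b' c' d') ->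
  P a b c d.
Proof.
move=> ab cd quarter small; apply: contrapT => nP.
pose rect := ((R * R) * (R * R))%type.
pose bad (t : rect) := [/\ a <= t.1.1 /\ t.1.2 <= b, t.1.1 <= t.1.2,
  c <= t.2.1 /\ t.2.2 <= d, t.2.1 <= t.2.2 & ~ P t.1.1 t.1.2 t.2.1 t.2.2].
have /choice[next nextP] (t : rect) : exists t' : rect, bad t ->
   [/\ bad t', t.1.1 <= t'.1.1 /\ t'.1.2 <= t.1.2, t.2.1 <= t'.2.1 /\ t'.2.2 <= t.2.2 &
     (t'.1.2 - t'.1.1) + (t'.2.2 - t'.2.1) = ((t.1.2 - t.1.1) + (t.2.2 - t.2.1)) / 2].
  case: (pselect (bad t)) => [|nb]; last by exists t.
  move: t => [[a1 b1] [c1 d1]] [/= [aa bb] ab1 [cc dd] cd1 nP1].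
  set p := (a1 + b1) / 2; set q := (c1 + d1) / 2.
  have [p1 p2] : a1 <= p /\ p <= b1 by rewrite /p; split; lra.
  have [q1 q2] : c1 <= q /\ q <= d1 by rewrite /q; split; lra.
  have [N|N] : ~ (P a1 p c1 q /\ P a1 p q d1) \/ ~ (P p b1 c1 q /\ P p b1 q d1).
    apply/not_andP => -[[? ?] [? ?]]; apply: nP1.
    exact: (quarter a1 b1 c1 d1).
  - case/not_andP: N => N; [exists ((a1, p), (c1, q))|exists ((a1, p), (q, d1))];
      move=> _; split=> //=; (try split=> //=); (try split);
      rewrite ?(le_trans aa) //; rewrite /p /q; lra.
  - case/not_andP: N => N; [exists ((p, b1), (c1, q))|exists ((p, b1), (q, d1))];
      move=> _; split=> //=; (try split=> //=); (try split);
      rewrite ?(le_trans aa) //; rewrite /p /q; lra.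
pose t n := iter n next ((a, b), (c, d)).
have bad_t n : bad (t n).
  elim: n => [|n IH]; first by split.
  by have [] := nextP _ IH.
have tS n := nextP _ (bad_t n).
have [x hx] : exists x, forall n, (t n).1.1 <= x <= (t n).1.2.
  apply: nested_intervals => // n; have [[_ ? _ _ _] [? ?] _ _] := tS n.
  - by apply/andP.
  - by [].
have [y hy] : exists y, forall n, (t n).2.1 <= y <= (t n).2.2.
  apply: nested_intervals => // n; have [[_ _ _ ? _] _ [? ?] _] := tS n.
  - by apply/andP.
  - by [].
have [r r0 hr] := small x y (hx 0%N) (hy 0%N).
have size n : ((t n).1.2 - (t n).1.1) + ((t n).2.2 - (t n).2.1) = ((b - a) + (d - c)) / 2 ^+ n.
  elim: n => [|n IH]; first by rewrite expr0 divr1.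
  by have [_ _ _ ->] := tS n; rewrite IH exprSr invfM mulrA.
have [n hn] : exists n, ((b - a) + (d - c)) / 2 ^+ n < r.
  have L0 : 0 <= (b - a) + (d - c) by lra.
  exists (Num.truncn (((b - a) + (d - c)) / r)).+1.
  have := truncnS_gt (((b - a) + (d - c)) / r).
  rewrite ltr_pdivrMr // => h.
  rewrite ltr_pdivrMr ?exprn_gt0 // (lt_le_trans h) // mulrC ler_pM2l //.
  by rewrite -natrX ler_nat ltnW // ltn_expl.
have [[? ?] _ [? ?] _ nPt] := bad_t n; apply: nPt.
by apply: hr => //; rewrite size.
Qed.

Lemma contour_integral_quarters g a p b c q d : a <= p <= b -> c <= q <= d ->
  (forall z : Cplx R, a <= complex.Re z <= b -> c <= complex.Im z <= d ->
    {for z, continuous g}) ->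
  contour_integral g a b c d =
    (contour_integral g a p c q + contour_integral g a p q d) +
    (contour_integral g p b c q + contour_integral g p b q d).
Proof.
move=> apb cqd hg.
have hedge a' b' c' : a <= a' -> b' <= b -> c <= c' <= d -> continuous_hedge g a' b' c'.
  by move=> aa bb cc x xab; apply: hg => //=; lra.
have vedge a' c' d' : a <= a' <= b -> c <= c' -> d' <= d -> continuous_vedge g a' c' d'.
  by move=> aa cc dd y ycd; apply: hg => //=; lra.
rewrite (contour_integral_vsplit apb); try by [apply: hedge; lra | apply: vedge; lra].
by rewrite !(contour_integral_hsplit cqd);
  try by [apply: hedge; lra | apply: vedge; lra].
Qed.

(** The contour integral is additive under quartering, and near every point it
    is at most [e] times the square of the size of the rectangle; bisection
    transfers this bound to the whole rectangle, for every [e]. *)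
Lemma goursat g a b c d : a <= b -> c <= d ->
  (forall z : Cplx R, a <= complex.Re z <= b -> c <= complex.Im z <= d ->
    derivable g z 1) ->
  contour_integral g a b c d = 0.
Proof.
move=> ab cd hg.
have cont z : a <= complex.Re z <= b -> c <= complex.Im z <= d -> {for z, continuous g}.
  by move=> za zc; apply: derivable_cplx_continuous; exact: hg.
(* The exponent 2 makes the bound exactly additive under quartering. *)
have bound e : 0 < e ->
    `|contour_integral g a b c d| <= 2 * e * ((b - a) + (d - c)) ^+ 2.
  move=> e0.
  apply: (@rectangle_bisection (fun a b c d =>
    `|contour_integral g a b c d| <= 2 * e * ((b - a) + (d - c)) ^+ 2)) => //.
  - move=> a' b' c' d' aa ab' bb cc cd' dd p q h1 h2 h3 h4.
    rewrite (@contour_integral_quarters _ _ p _ _ q); first last.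
    + by move=> z za zc; apply: cont; lra.
    + by rewrite /q; lra.
    + by rewrite /p; lra.
    have -> : 2 * e * (b' - a' + (d' - c')) ^+ 2 =
      (2 * e * (p - a' + (q - c')) ^+ 2 + 2 * e * (p - a' + (d' - q)) ^+ 2) +
      (2 * e * (b' - p + (q - c')) ^+ 2 + 2 * e * (b' - p + (d' - q)) ^+ 2).
      by rewrite /p /q; field.
    by rewrite (le_trans (ler_normD _ _)) // lerD // (le_trans (ler_normD _ _)) // lerD.
  - move=> x y xab ycd; have /derivableP_modulus[l hl] := hg (Complex x y) xab ycd.
    have [r r0 hr] := hl e e0; exists r => // a' b' c' d' aa bb cc dd xa yc small.
    apply: (@contour_integral_local _ g (Complex x y) l) => //; first [lra | idtac].
    + by move=> u uab; apply: cont => //=; lra.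
    + by move=> u uab; apply: cont => //=; lra.
    + by move=> u uab; apply: cont => //=; lra.
    + by move=> u uab; apply: cont => //=; lra.
    move=> w /andP[w1 w2] /andP[w3 w4]; apply: hr.
    rewrite (le_lt_trans (modulus_le_ReIm _)) // complex_ReB complex_ImB /=.
    rewrite (le_lt_trans _ small) //.
    by move: xa yc => /andP[? ?] /andP[? ?]; rewrite lerD // ler_norml; apply/andP; split; lra.
apply/eqP; rewrite -normr_le0; apply/ler_addgt0Pr => e e0; rewrite add0r.
set K := 2 * ((b - a) + (d - c)) ^+ 2.
have K0 : 0 < K + 1 by rewrite ltr_wpDl // mulr_ge0 // sqr_ge0.
have := bound (e / (K + 1)) (divr_gt0 e0 K0).
rewrite (_ : 2 * _ * _ = e * (K / (K + 1))); last by rewrite /K; ring.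
by move=> /le_trans -> //; rewrite ler_piMr ?ltW // ltr_pdivrMr // mul1r ltrDl.
Qed.

End Goursat.

(** * Cauchy estimate and Weierstrass convergence theorem *)

Section Cauchy.
Context {R : realType}.
Implicit Types (g phi : Cplx R -> Cplx R) (r d : R) (z w l : Cplx R).

(** The frame between the two squares consists of four rectangles that avoid 0,
    to which [goursat] applies. *)
Lemma contour_integral_annulus g r d : 0 < d <= r ->
  (forall z, z != 0 -> - r <= complex.Re z <= r -> - r <= complex.Im z <= r ->
    derivable g z 1) ->
  contour_integral g (- r) r (- r) r = contour_integral g (- d) d (- d) d.
Proof.
move=> dr hg.
have hedge a b c : - r <= a -> b <= r -> 0 < c \/ c < 0 -> - r <= c <= r ->
    continuous_hedge g a b c.
  move=> ra br c0 hc x xab; apply/derivable_cplx_continuous/hg => //=; last lra.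
  by apply/eqP => -[_ cE]; lra.
have vedge a c b : - r <= c -> b <= r -> 0 < a \/ a < 0 -> - r <= a <= r ->
    continuous_vedge g a c b.
  move=> rc br a0 ha y ycb; apply/derivable_cplx_continuous/hg => //=; last lra.
  by apply/eqP => -[aE _]; lra.
have zero a b c e : - r <= a -> a <= b -> b <= r -> - r <= c -> c <= e -> e <= r ->
    (0 < a \/ b < 0 \/ 0 < c \/ e < 0) -> contour_integral g a b c e = 0.
  move=> ra ab br rc ce er out; apply: goursat => // z zab zce; apply: hg; try lra.
  by apply/eqP => z0; move: zab zce; rewrite z0 /=; lra.
rewrite (@contour_integral_vsplit _ g (- d));
  try by [lra | apply: hedge; lra | apply: vedge; lra].
rewrite [X in X + _]zero ?add0r; try lra.
rewrite (@contour_integral_vsplit _ g d);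
  try by [lra | apply: hedge; lra | apply: vedge; lra].
rewrite [X in _ + X]zero ?addr0; try lra.
rewrite (@contour_integral_hsplit _ g (- d));
  try by [lra | apply: hedge; lra | apply: vedge; lra].
rewrite [X in X + _]zero ?add0r; try lra.
rewrite (@contour_integral_hsplit _ g d);
  try by [lra | apply: hedge; lra | apply: vedge; lra].
by rewrite [X in _ + X]zero ?addr0; try lra.
Qed.


Lemma square_contour_bounds g d : 0 < d ->
  (forall z, z != 0 -> - d <= complex.Re z <= d -> - d <= complex.Im z <= d ->
    {for z, continuous g}) ->
  (forall K, (forall x, - d <= x <= d ->
      K <= complex.Re (g (Complex x (- d))) - complex.Re (g (Complex x d)) /\
      K <= complex.Im (g (Complex (- d) x)) - complex.Im (g (Complex d x))) ->
    4 * K * d <= contour_integral g (- d) d (- d) d) /\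
  (forall L, (forall x, - d <= x <= d ->
      complex.Re (g (Complex x (- d))) - complex.Re (g (Complex x d)) <= L /\
      complex.Im (g (Complex (- d) x)) - complex.Im (g (Complex d x)) <= L) ->
    contour_integral g (- d) d (- d) d <= 4 * L * d).
Proof.
move=> d0 hg; have dd : - d <= d by lra.
have dn : (d == 0) = false by rewrite gt_eqF.
have h1 : segment_continuous
    (fun x => complex.Re (g (Complex x (- d))) - complex.Re (g (Complex x d))) (- d) d.
  apply: segment_continuousB; apply: Re_edge_continuous => x xd; apply: hg;
    rewrite //= ?dd ?lexx //.
    by rewrite eq_complex /= oppr_eq0 dn andbF.
  by rewrite eq_complex /= dn andbF.
have h2 : segment_continuous
    (fun y => complex.Im (g (Complex d y)) - complex.Im (g (Complex (- d) y))) (- d) d.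
  apply: segment_continuousB; apply: Im_edge_continuous => x xd; apply: hg;
    rewrite //= ?dd ?lexx //.
    by rewrite eq_complex /= dn.
  by rewrite eq_complex /= oppr_eq0 dn.
split=> K hb.
  have a1 := segment_integral_ge (r := K) dd h1 (fun x xd => (hb x xd).1).
  have b1 : segment_integral
      (fun y => complex.Im (g (Complex d y)) - complex.Im (g (Complex (- d) y))) (- d) d
    <= - K * (d - - d).
    by apply: segment_integral_le => // y yd; rewrite -lerN2 opprK opprB; exact: (hb y yd).2.
  rewrite /contour_integral; move: a1 b1; rewrite opprK.
  set I1 := segment_integral _ _ _; set I2 := segment_integral _ _ _.
  by move=> a1 b1; lra.
have a1 := segment_integral_le (r := K) dd h1 (fun x xd => (hb x xd).1).
have b1 : - K * (d - - d) <= segment_integral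
    (fun y => complex.Im (g (Complex d y)) - complex.Im (g (Complex (- d) y))) (- d) d.
  by apply: segment_integral_ge => // y yd; rewrite -lerN2 opprK opprB; exact: (hb y yd).2.
rewrite /contour_integral; move: a1 b1; rewrite opprK.
set I1 := segment_integral _ _ _; set I2 := segment_integral _ _ _.
by move=> a1 b1; lra.
Qed.

(** Near w the function (phi z - phi w) / (z - w)^2 is l / (z - w) up to a small
    multiple of 1 / (z - w). Its integral along a square around w does not depend
    on the square: small squares give about 2 pi |l|, of which the crude bound 4 |l|
    is enough, and the square of half-side [r] gives at most 16 M / r. *)
Lemma cauchy_estimate phi w l M r : 0 < r ->
  (forall z, modulus (z - w) <= 2 * r -> derivable phi z 1) ->
  (forall z, modulus (z - w) <= 2 * r -> modulus (phi z) <= M) ->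
  has_derivative phi w l -> modulus l <= 4 * M / r.
Proof.
move=> r0 dphi Mphi dl.
have M0 : 0 <= M.
  apply: le_trans (Mphi w _); rewrite ?modulus_ge0 //.
  by rewrite subrr modulus0 mulr_ge0 // ltW.
have [->|l0] := eqVneq l 0; first by rewrite modulus0 divr_ge0 ?(ltW r0) // mulr_ge0.
have ml0 := modulus_gt0 l0.
(* [mu] is - i times the conjugate of [l], so that mu l / h = - i |l|^2 / h, whose
   contour integral around 0 is real and positive. *)
pose mu : Cplx R := Complex (- complex.Im l) (- complex.Re l).
have mmu : modulus mu = modulus l.
  by rewrite !modulusE /= !sqrrN addrC.
set N := modulus l ^+ 2.
have mul : mu * l = Complex 0 (- N).
  rewrite /N modulusE sqr_sqrtr ?addr_ge0 ?sqr_ge0 //.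
  by apply/eqP; rewrite eq_complex complex_ReM complex_ImM /=; apply/andP; split; apply/eqP; ring.
pose g h : Cplx R := mu * ((phi (h + w) - phi w) * (h * h)^-1).
have square h : - r <= complex.Re h <= r -> - r <= complex.Im h <= r ->
    modulus (h + w - w : Cplx R) <= 2 * r.
  move=> hr hi; rewrite addrK (le_trans (modulus_le_ReIm _)) // mulr_natl mulr2n.
  by rewrite lerD // ler_norml.
have dg z : z != 0 -> - r <= complex.Re z <= r -> - r <= complex.Im z <= r -> derivable g z 1.
  move=> z0 zr zi; have dshift : derivable (fun h => phi (h + w)) z 1.
    have /derivableP_modulus[k hk] := dphi _ (square _ zr zi).
    apply/derivableP_modulus; exists k => e e0; have [d d0 hd] := hk e e0.
    exists d => // h hz; have := hd (h + w).
    by rewrite opprD addrACA subrr addr0; apply.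
  apply: (@derivableM _ _ (cst mu) (fun h => (phi (h + w) - phi w) * (h * h)^-1)).
    exact: derivable_cst.
  apply: (@derivableM _ _ (fun h => phi (h + w) - phi w) (fun h => (h * h)^-1)).
    apply: (@derivableB _ _ _ (fun h => phi (h + w)) (cst (phi w))); first exact: dshift.
    exact: derivable_cst.
  apply: (@derivableV _ _ (fun h : Cplx R => h * h)).
    by rewrite mulf_neq0.
  by apply: (@derivableM _ _ id id); exact: derivable_id.
have cg d z : d <= r -> z != 0 -> - d <= complex.Re z <= d -> - d <= complex.Im z <= d ->
    {for z, continuous g}.
  move=> dr z0 /andP[? ?] /andP[? ?]; apply: derivable_cplx_continuous.
  by apply: dg => //; apply/andP; split; lra.
have inner e : 0 < e -> exists2 d, 0 < d <= r &
    4 * N - 8 * modulus l * e <= contour_integral g (- d) d (- d) d.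
  move=> e0; have [d0 d00 hd] := dl e e0.
  pose d := Num.min r (d0 / 3).
  have d_gt0 : 0 < d by rewrite lt_min r0 divr_gt0.
  have dr : d <= r by rewrite ge_min lexx.
  have dd0 : d + d < d0.
    have : d <= d0 / 3 by rewrite ge_min lexx orbT.
    by lra.
  exists d; first by rewrite d_gt0.
  have close (h : Cplx R) : d <= modulus h -> `|complex.Re h| <= d -> `|complex.Im h| <= d ->
      modulus (g h - mu * l * h^-1 : Cplx R) <= modulus l * e / d.
    move=> dh hr hi; have h_gt0 : 0 < modulus h by exact: lt_le_trans dh.
    have h0 : h != 0 by apply/eqP => h0; move: h_gt0; rewrite h0 modulus0 ltxx.
    have hh : modulus (h + w - w : Cplx R) < d0.
      by rewrite addrK (le_lt_trans (modulus_le_ReIm _)) // (le_lt_trans _ dd0) // lerD.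
    have := hd (h + w) hh; rewrite addrK => hl.
    have -> : g h - mu * l * h^-1 = mu * ((phi (h + w) - phi w - l * h) * (h * h)^-1).
      by rewrite /g; field.
    rewrite !modulusM mmu -mulrA; apply: ler_wpM2l; first exact: modulus_ge0.
    rewrite modulusV modulusM ler_pdivrMr ?mulr_gt0 //.
    rewrite (le_trans hl) // mulrA ler_wpM2r ?modulus_ge0 //.
    by rewrite -mulrA ler_peMr ?(ltW e0) // mulrC ler_pdivlMr // mul1r.
  have main (h : Cplx R) : mu * l * h^-1 = Complex
      (- (N * (complex.Im h) / (complex.Re h ^+ 2 + complex.Im h ^+ 2)))
      (- (N * (complex.Re h) / (complex.Re h ^+ 2 + complex.Im h ^+ 2))).
    rewrite mul; case: h => x y; apply/eqP; rewrite eq_complex complex_ReM complex_ImM /=.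
    by apply/andP; split; apply/eqP; ring.
  have N0 : 0 <= N by exact: sqr_ge0.
  have large x : - d <= x <= d -> N / (2 * d) <= N * d / (d ^+ 2 + x ^+ 2).
    move=> /andP[x1 x2]; rewrite -mulrA ler_wpM2l // ler_pdivlMr; last first.
      by rewrite ltr_pwDl ?exprn_gt0 ?sqr_ge0.
    rewrite mulrC ler_pdivrMr ?mulr_gt0 //.
    by rewrite (_ : d * (2 * d) = d ^+ 2 + d ^+ 2); [rewrite lerD2l; nra|ring].
  set K := N / (2 * d) in large.
  have [lower _] := square_contour_bounds d_gt0 (fun z => cg d z dr).
  set B := modulus l * e / d in close.
  have := lower (2 * (K - B)).
  rewrite (_ : 4 * (2 * (K - B)) * d = 4 * N - 8 * modulus l * e); last first.
    by rewrite /K /B; field; rewrite gt_eqF.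
  apply=> x xd; have kx := large x xd; have xd' : `|x| <= d by rewrite ler_norml.
  have dd : `|d| <= d by rewrite ger0_norm // ltW.
  have ddN : `|- d| <= d by rewrite normrN.
  have hedge y : `|y| = d -> `|complex.Re (g (Complex x y)) + N * y / (x ^+ 2 + y ^+ 2)| <= B.
    move=> yd; have := close (Complex x y); rewrite main /= yd lexx => h.
    have := le_trans (ler_Re_modulus _) (h _ xd' isT).
    rewrite complex_ReB /= opprK; apply.
    by rewrite -[leLHS]yd (le_trans _ (ler_Im_modulus _)).
  have vedge y : `|y| = d -> `|complex.Im (g (Complex y x)) + N * y / (y ^+ 2 + x ^+ 2)| <= B.
    move=> yd; have := close (Complex y x); rewrite main /= yd lexx => h.
    have := le_trans (ler_Im_modulus _) (h _ isT xd').
    rewrite complex_ImB /= opprK; apply.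
    by rewrite -[leLHS]yd (le_trans _ (ler_Re_modulus _)).
  have d1 : `|d| = d by rewrite gtr0_norm.
  have d2 : `|- d| = d by rewrite normrN.
  move: (hedge _ d1) (hedge _ d2) (vedge _ d1) (vedge _ d2) kx.
  rewrite !sqrrN (addrC (x ^+ 2)) !mulrN !mulNr.
  set k := N * d / _; rewrite !ler_norml => /andP[? ?] /andP[? ?] /andP[? ?] /andP[? ?] ?.
  by split; lra.
have outer : contour_integral g (- r) r (- r) r <= 16 * modulus l * M / r.
  have [_ upper] := square_contour_bounds r0 (fun z => cg r z (lexx r)).
  pose B := modulus l * (2 * M) / (r * r).
  have gB (h : Cplx R) : r <= modulus h -> `|complex.Re h| <= r -> `|complex.Im h| <= r ->
      modulus (g h) <= B.
    move=> rh hr hi; have h0 : 0 < modulus h by exact: lt_le_trans rh.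
    rewrite /g !modulusM mmu /B -[leRHS]mulrA; apply: ler_wpM2l; first exact: modulus_ge0.
    apply: ler_pM; rewrite ?modulus_ge0 //.
      rewrite (le_trans (modulusD _ _)) // modulusN mulr_natl mulr2n lerD // Mphi //.
        by rewrite square // -ler_norml.
      by rewrite subrr modulus0 mulr_ge0 // ltW.
    by rewrite modulusV modulusM lef_pV2 ?posrE ?mulr_gt0 // ler_pM // ltW.
  rewrite (_ : 16 * modulus l * M / r = 4 * (2 * B) * r); last by rewrite /B; field; rewrite gt_eqF.
  apply: upper => x xr; have xr' : `|x| <= r by rewrite ler_norml.
  have dd : `|r| <= r by rewrite ger0_norm // ltW.
  have ddN : `|- r| <= r by rewrite normrN.
  have rE : r = `|r| by rewrite gtr0_norm.
  have rNE : r = `|- r| by rewrite normrN.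
  have hedge y : r = `|y| -> `|complex.Re (g (Complex x y))| <= B.
    move=> ry; rewrite (le_trans (ler_Re_modulus _)) // gB //= -?ry //.
    by rewrite ry (le_trans _ (ler_Im_modulus _)).
  have vedge y : r = `|y| -> `|complex.Im (g (Complex y x))| <= B.
    move=> ry; rewrite (le_trans (ler_Im_modulus _)) // gB //= -?ry //.
    by rewrite ry (le_trans _ (ler_Re_modulus _)).
  move: (hedge _ rE) (hedge _ rNE) (vedge _ rE) (vedge _ rNE).
  rewrite !ler_norml => /andP[? ?] /andP[? ?] /andP[? ?] /andP[? ?].
  by split; lra.
rewrite -(ler_pM2l ml0); apply/ler_addgt0Pr => e e0.
have [|d dr hd] := inner (e / (2 * modulus l)); first by rewrite divr_gt0 // mulr_gt0.
have := le_trans hd (_ : _ <= 16 * modulus l * M / r).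
rewrite -(contour_integral_annulus dr dg) => /(_ outer).
rewrite -expr2 -/N (_ : 8 * _ * _ = 4 * e); last by field; rewrite gt_eqF.
rewrite (_ : 16 * modulus l * M / r = 4 * (modulus l * (4 * M / r))); last by ring.
by lra.
Qed.

End Cauchy.

Section Weierstrass.
Context {R : realType}.
Implicit Types (g phi : Cplx R -> Cplx R) (r d : R) (z w l h : Cplx R).

Lemma has_derivativeB g phi z k l : has_derivative g z k -> has_derivative phi z l ->
  has_derivative (fun w => g w - phi w) z (k - l).
Proof.
move=> hk hl e e0; have e2 : 0 < e / 2 by rewrite divr_gt0.
have [d1 d10 h1] := hk _ e2; have [d2 d20 h2] := hl _ e2.
exists (Num.min d1 d2); first by rewrite lt_min d10.
move=> w; rewrite lt_min => /andP[/h1 k1 /h2 k2].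
have -> : g w - phi w - (g z - phi z) - (k - l) * (w - z) =
  (g w - g z - k * (w - z)) - (phi w - phi z - l * (w - z)) by ring.
rewrite (le_trans (modulusD _ _)) // modulusN (le_trans (lerD k1 k2)) //.
by rewrite -mulrDl -splitr.
Qed.

(** [pr] stands for the real or the imaginary part: the mean value theorem is
    about real-valued functions only. *)
Lemma is_derive_projection (pr : R[i] -> R) phi w h l (t : R) :
  (forall z z', pr (z - z') = pr z - pr z') -> (forall (s : R) z, pr (s%:C%C * z) = s * pr z) ->
  (forall z, `|pr z| <= modulus z) ->
  has_derivative phi (w + t%:C%C * h) l ->
  is_derive t 1 (fun s : R => pr (phi (w + s%:C%C * h))) (pr (l * h)).
Proof.
move=> prB prZ prm hl.
suff lim : (fun s : R => s^-1 *: (pr (phi (w + (s *: 1 + t)%:C%C * h)) - pr (phi (w + t%:C%C * h))))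
    @ 0^' --> pr (l * h).
  by apply: DeriveDef; [apply/cvg_ex; exists (pr (l * h))|apply: cvg_lim].
apply/cvgrPdist_lt => e e0; rewrite near_withinE.
have H0 : 0 < modulus h + 1 by rewrite ltr_wpDl // modulus_ge0.
have [d d0 hd] := hl (e / (2 * (modulus h + 1))) (divr_gt0 e0 (mulr_gt0 (ltr0Sn _ 1) H0)).
apply/nbhs_normP; exists (d / (modulus h + 1)) => /=; first by rewrite divr_gt0.
move=> s /=; rewrite sub0r normrN ltr_pdivlMr // => sd s0.
have s0' : 0 < `|s| by rewrite normr_gt0.
have E : w + (s%:A + t)%:C%C * h - (w + t%:C%C * h) = s%:C%C * h.
  by rewrite /GRing.scale /= mulr1 rmorphD /=; ring.
have := hd (w + (s%:A + t)%:C%C * h); rewrite E modulusM modulus_real => k.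
have small : `|s| * modulus h < d.
  by rewrite (le_lt_trans _ sd) // ler_wpM2l // lerDl.
rewrite -prB /GRing.scale /= -prZ -prB (le_lt_trans (prm _)) //.
have -> : l * h - (s^-1)%:C%C * (phi (w + (s * 1 + t)%:C%C * h) - phi (w + t%:C%C * h)) =
   - ((s^-1)%:C%C * (phi (w + (s * 1 + t)%:C%C * h) - phi (w + t%:C%C * h) - l * (s%:C%C * h))).
  have ss : (s^-1)%:C%C * s%:C%C = 1 :> R[i] by rewrite -rmorphM mulVf.
  set X := phi _ - phi _.
  rewrite [in RHS]mulrBr opprB (_ : _ * (l * _) = l * h * ((s^-1)%:C%C * s%:C%C)); last by ring.
  by rewrite ss mulr1.
rewrite modulusN modulusM modulus_real normfV mulrC ltr_pdivrMr //.
apply: le_lt_trans (k small) _.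
rewrite (_ : e / _ * _ = e * `|s| * (modulus h / (2 * (modulus h + 1)))); last first.
  by field; rewrite gt_eqF.
rewrite gtr_pMr ?mulr_gt0 // ltr_pdivrMr ?mulr_gt0 //.
by have := modulus_ge0 h; lra.
Qed.

Lemma projection_lipschitz (pr : R[i] -> R) phi w h (L : R) :
  (forall z z', pr (z - z') = pr z - pr z') -> (forall (s : R) z, pr (s%:C%C * z) = s * pr z) ->
  (forall z, `|pr z| <= modulus z) ->
  (forall t : R, 0 <= t <= 1 ->
    exists2 l, has_derivative phi (w + t%:C%C * h) l & modulus l <= L) ->
  `|pr (phi (w + h)) - pr (phi w)| <= L * modulus h.
Proof.
move=> prB prZ prm hphi.
have /choice[dphi hd] (t : R) : exists l, 0 <= t <= 1 ->
    has_derivative phi (w + t%:C%C * h) l /\ modulus l <= L.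
  have [t01|nt] := pselect (0 <= t <= 1); last by exists 0.
  by have [l ? ?] := hphi t t01; exists l.
pose k t := pr (phi (w + t%:C%C * h)).
have dk (t : R) : 0 <= t <= 1 -> is_derive t 1 k (pr (dphi t * h)).
  by move=> /hd[? _]; exact: (is_derive_projection prB prZ prm).
have [||c cc] := @MVT_segment R k (fun t => pr (dphi t * h)) 0 1 ler01.
- by move=> x; rewrite in_itv /= => /andP[x0 x1]; apply: dk; rewrite !ltW.
- by apply: derivable_within_continuous => x; rewrite in_itv /= => /dk [].
rewrite /k mul1r mul0r !addr0 subr0 mulr1 => ->.
rewrite (le_trans (prm _)) // modulusM ler_wpM2r ?modulus_ge0 //.
by apply: (hd c _).2; move: cc; rewrite in_itv.
Qed.

(** The Cauchy estimate on balls of radius [r] around the points of the segment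
    bounds the derivative there by 8 M / r. The mean value theorem is then applied
    to the real and to the imaginary part, which doubles the constant. *)
Lemma holomorphic_lipschitz phi w h M r : 0 < r ->
  (forall z, modulus (z - w) <= 2 * r -> derivable phi z 1) ->
  (forall z, modulus (z - w) <= 2 * r -> modulus (phi z) <= M) ->
  modulus h <= r -> modulus (phi (w + h) - phi w) <= 16 * M / r * modulus h.
Proof.
move=> r0 dphi Mphi hr.
have deriv (t : R) : 0 <= t <= 1 ->
    exists2 l, has_derivative phi (w + t%:C%C * h) l & modulus l <= 8 * M / r.
  move=> /andP[t0 t1].
  have th : modulus (t%:C%C * h : Cplx R) <= r.
    by rewrite modulusM modulus_real ger0_norm // (le_trans _ hr) // ler_piMl ?modulus_ge0.
  have sub z : modulus (z - (w + t%:C%C * h)) <= 2 * (r / 2) -> modulus (z - w) <= 2 * r.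
    rewrite (_ : 2 * (r / 2) = r); last by field.
    move=> zr; rewrite (le_trans (modulus_dist_trans (w + t%:C%C * h) _ _)) //.
    by rewrite mulr_natl mulr2n lerD // addrAC subrr add0r.
  have /derivableP_modulus[l hl] : derivable phi (w + t%:C%C * h) 1.
    apply: dphi; rewrite addrAC subrr add0r (le_trans th) //.
    by rewrite ler_peMl ?ltW // ltr1n.
  exists l => //; rewrite (_ : 8 * M / r = 4 * M / (r / 2)); last by field; rewrite gt_eqF.
  apply: cauchy_estimate hl; first by rewrite divr_gt0.
    by move=> z /sub /dphi.
  by move=> z /sub /Mphi.
rewrite (le_trans (modulus_le_ReIm _)) // complex_ReB complex_ImB.
rewrite (_ : 16 * M / r * modulus h = 8 * M / r * modulus h + 8 * M / r * modulus h); last by ring.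
apply: lerD.
  apply: (projection_lipschitz (pr := @complex.Re R)) => //.
  - exact: complex_ReB.
  - by move=> s z; rewrite complex_ReM /= mul0r subr0.
  - exact: ler_Re_modulus.
apply: (projection_lipschitz (pr := @complex.Im R)) => //.
- exact: complex_ImB.
- by move=> s z; rewrite complex_ImM /= mul0r addr0.
- exact: ler_Im_modulus.
Qed.

Lemma modulus_lim_le (V : normedModType R[i]) (u : nat -> V) (l c : V) m B :
  u @ \oo --> l -> (forall n, (m <= n)%N -> modulus (u n - c) <= B) -> modulus (l - c) <= B.
Proof.
move=> /cvg_modulusP ul uB; apply/ler_addgt0Pr => e /ul [N _ hN].
rewrite [leRHS]addrC (le_trans (modulus_dist_trans (u (maxn N m)) _ _)) // lerD //.
  by apply/ltW/hN => /=; rewrite leq_maxl.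
by apply: uB; rewrite leq_maxr.
Qed.

(** The Lipschitz bound for F n - F m, of order t m, survives in the limit in n;
    so the difference quotients of [phi] at [w] are within O(t m) of those of F m,
    and the derivatives of the F n at [w] form a Cauchy sequence. *)
Lemma weierstrass (F : nat -> Cplx R -> Cplx R) phi w r (t : nat -> R) : 0 < r ->
  (forall n z, modulus (z - w) <= 2 * r -> derivable (F n) z 1) ->
  (forall e, 0 < e -> exists m, t m < e) ->
  (forall m n z, (m <= n)%N -> modulus (z - w) <= 2 * r -> modulus (F n z - F m z) <= t m) ->
  (forall z, modulus (z - w) <= 2 * r -> (fun n => F n z) @ \oo --> phi z) ->
  derivable phi w 1.
Proof.
move=> r0 dF t0 Ft lim.
have ww : modulus (w - w) <= 2 * r by rewrite subrr modulus0 mulr_ge0 // ltW.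
have /choice[l hl] n : exists l, has_derivative (F n) w l.
  exact/derivableP_modulus/dF.
have dB m n z : modulus (z - w) <= 2 * r -> derivable (fun z => F n z - F m z) z 1.
  by move=> zr; apply: derivableB; exact: dF.
have l_cauchy m n : (m <= n)%N -> modulus (l n - l m) <= 4 / r * t m.
  move=> mn; rewrite mulrAC.
  exact: (@cauchy_estimate R (fun z => F n z - F m z) w (l n - l m) (t m) r r0 (dB m n)
    (fun z => Ft m n z mn) (has_derivativeB (hl n) (hl m))).
have /cvg_ex[k hk] : cvg (l @ \oo).
  apply: complex_complete l_cauchy => e e0.
  have [m hm] := t0 (e / (4 / r)) (divr_gt0 e0 (divr_gt0 (ltr0Sn _ 3) r0)).
  by exists m; rewrite mulrC -ltr_pdivlMr // divr_gt0.
apply/derivableP_modulus; exists k => e e0.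
have [m hm] := t0 (e / 2 / (20 / r))
  (divr_gt0 (divr_gt0 e0 (ltr0Sn _ 1)) (divr_gt0 (ltr0Sn _ 19) r0)).
have [d d0 hd] := hl m (e / 2) (divr_gt0 e0 (ltr0Sn _ 1)).
exists (Num.min d r); first by rewrite lt_min d0.
move=> z; rewrite lt_min => /andP[zd zr].
have zr2 : modulus (z - w) <= 2 * r by rewrite (le_trans (ltW zr)) // ler_peMl ?ltW // ltr1n.
have k_near : modulus (k - l m) <= 4 / r * t m by apply: modulus_lim_le hk (l_cauchy m).
have tail : modulus ((phi z - phi w) - (F m z - F m w)) <= 16 * t m / r * modulus (z - w).
  apply: (@modulus_lim_le _ (fun n => F n z - F n w) _ _ m).
    by apply: cvgB; exact: lim.
  move=> n mn.
  have := @holomorphic_lipschitz (fun z => F n z - F m z) w (z - w) (t m) r r0.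
  have -> : F n z - F n w - (F m z - F m w) =
      (F n (w + (z - w)) - F m (w + (z - w))) - (F n w - F m w).
    by rewrite addrC (addrC w) subrK; ring.
  by apply; [exact: (dB m n)|exact: (fun z => Ft m n z mn)|exact: ltW].
have -> : phi z - phi w - k * (z - w) = ((phi z - phi w) - (F m z - F m w)) +
   ((F m z - F m w - l m * (z - w)) - (k - l m) * (z - w)) by ring.
rewrite (le_trans (modulusD _ _)) // (le_trans (lerD tail (modulusD _ _))) //.
rewrite modulusN modulusM.
have := hd z zd; have := ler_wpM2r (modulus_ge0 (z - w)) k_near.
set D := modulus (z - w) => h1 h2.
rewrite (le_trans (lerD (lexx _) (lerD h2 h1))) //.
rewrite (_ : _ + _ = (20 / r * t m + e / 2) * D); last by ring.
apply: ler_wpM2r; first exact: modulus_ge0.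
rewrite [leRHS]splitr lerD2r ltW // mulrC -ltr_pdivlMr // divr_gt0 //.
Qed.

End Weierstrass.

(** * Normally convergent products *)

Section Square.
Context {R : realType}.

(** A compact neighbourhood of [w]: squares are used because they are products
    of two segments. *)
Definition closed_square (w : Cplx R) (r : R) : set (Cplx R) :=
  [set z | `|complex.Re (z - w)| <= r /\ `|complex.Im (z - w)| <= r].

Lemma closed_square_compact w r : compact (closed_square w r).
Proof.
pose q (p : R * R) : Cplx R := Complex p.1 p.2.
have q_cont : continuous q.
  move=> p; apply: (iffRL (cvg_modulusP (FF := nbhs_filter p) _ _)) => e e0.
  have e2 : 0 < e / 2 by rewrite divr_gt0.
  have h1 : \forall s \near p, `|p.1 - s.1| < e / 2.
    have /(iffLR (cvgrPdist_lt (FF := nbhs_filter p) _ _)) : (@fst R R) @ p --> p.1.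
      exact: cvg_fst.
    exact.
  have h2 : \forall s \near p, `|p.2 - s.2| < e / 2.
    have /(iffLR (cvgrPdist_lt (FF := nbhs_filter p) _ _)) : (@snd R R) @ p --> p.2.
      exact: cvg_snd.
    exact.
  near=> s; rewrite (le_lt_trans (modulus_le_ReIm _)) // complex_ReB complex_ImB /=.
  by rewrite [ltRHS]splitr ltrD //; near: s; [exact: h1|exact: h2].
set a := complex.Re w; set b := complex.Im w.
have -> : closed_square w r = q @` (`[a - r, a + r]%classic `*` `[b - r, b + r]%classic).
  apply/seteqP; split=> [z [zr zi]|z [[x y] [/= xr yr] <-]].
    exists (complex.Re z, complex.Im z); last by rewrite /q; case: z {zr zi}.
    by split; rewrite /= in_itv /= -ler_distlC distrC -?complex_ReB -?complex_ImB.
  split; rewrite ?complex_ReB ?complex_ImB /=; rewrite distrC ler_distlC.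
    by move: xr; rewrite in_itv.
  by move: yr; rewrite in_itv.
apply: continuous_compact; first exact: continuous_subspaceT.
by apply: compact_setX; exact: segment_compact.
Unshelve. all: by end_near. Qed.

End Square.

Section Sequences.
Context {R : realType}.

(** Since 1 + b k <= exp (b k), the sequence stays below M exp (\sum_k b k), so its
    increments are summable. The rate [t] is chosen before [u]: this yields
    uniform convergence when [u] depends on a parameter. *)
Lemma small_increments_cauchy (b : nat -> R) (T M : R) :
  (forall k, 0 <= b k) -> (forall n, \sum_(k < n) b k <= T) -> 0 <= M ->
  exists2 t : nat -> R, (forall e, 0 < e -> exists m, t m < e) &
    forall (V : normedModType R[i]) (u : nat -> V), modulus (u 0%N) <= M ->
      (forall n, modulus (u n.+1 - u n) <= b n * modulus (u n)) ->
      forall m n, (m <= n)%N -> modulus (u n - u m) <= t m.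
Proof.
move=> b0 bT M0.
pose S n := \sum_(k < n) b k.
have Smono m n : (m <= n)%N -> S m <= S n.
  move=> mn; rewrite -(subnKC mn) /S; elim: (n - m)%N => [|k IH]; first by rewrite addn0.
  by rewrite addnS big_ord_recr /= (le_trans IH) // lerDl.
have hsup : has_sup (range S).
  by split; [exists (S 0%N), 0%N|exists T => _ [n _ <-]; exact: bT].
have SS k : S k.+1 = S k + b k by rewrite /S big_ord_recr.
pose L := sup (range S).
have SL n : S n <= L by apply: sup_upper_bound => //; exists n.
pose B := M * expR L + 1.
have B0 : 0 < B by rewrite ltr_wpDl // mulr_ge0 // expR_ge0.
exists (fun m => B * (L - S m)) => [e e0|V u u0 ub m n mn].
  have [_ [m _ <-] hm] := sup_adherent (divr_gt0 e0 B0) hsup.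
  by exists m; rewrite mulrC -ltr_pdivlMr // ltrBlDr addrC -ltrBlDr.
have growth k : modulus (u k) <= M * expR (S k).
  elim: k => [|k IH]; first by rewrite /S big_ord0 expR0 mulr1.
  rewrite (le_trans (modulus_le_dist _ (u k))) //.
  have := ub k; have := IH; have := expR_ge1Dx (b k).
  rewrite SS expRD mulrA => h1 h2 h3.
  rewrite (le_trans (lerD h3 (lexx _))) //.
  rewrite (_ : _ + _ = modulus (u k) * (1 + b k)); last by ring.
  by apply: ler_pM => //; rewrite ?modulus_ge0 // addr_ge0.
have bounded k : modulus (u k) <= B.
  rewrite (le_trans (growth k)) // /B ler_wpDr // ler_wpM2l // ler_expR.
  exact: SL.
have incr : modulus (u n - u m) <= B * (S n - S m).
  rewrite -(subnKC mn); elim: (n - m)%N => [|k IH].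
    by rewrite addn0 !subrr modulus0 mulr0.
  rewrite addnS (le_trans (modulus_dist_trans (u (m + k)%N) _ _)) //.
  rewrite SS addrAC [leRHS]mulrDr [leLHS]addrC lerD //.
  by rewrite (le_trans (ub _)) // mulrC ler_wpM2r.
by rewrite (le_trans incr) // ler_pM2l // lerD2r.
Qed.

(** A point of [K] makes the suprema nonnegative; being terms of a finite sum
    they are then finite. *)
Lemma normally_convergent_bound {A : fdNormedAltAlgType R[i]} (G K : set (Cplx R))
    (f : nat -> Cplx R -> A) : normally_convergent G f -> compact K -> K `<=` G -> K !=set0 ->
  exists2 a : nat -> R, (forall k, 0 <= a k) /\ (exists T, forall n, \sum_(k < n) a k <= T) &
    forall k z, K z -> modulus (f k z - aone) <= a k.
Proof.
move=> /(_ K) + cK KG [z0 Kz0] => /(_ cK KG).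
set s := fun k => sup_norm K (fun z => f k z - aone); rewrite -/s => sfin.
have s_ub k z : K z -> ((modulus (f k z - aone))%:E <= s k)%E.
  by move=> Kz; apply: ereal_sup_ubound; exists z.
have s0 k : (0 <= s k)%E.
  by apply: le_trans (s_ub k z0 Kz0); rewrite lee_fin modulus_ge0.
have partial n : (\sum_(0 <= k < n) s k <= \sum_(0 <= k <oo) s k)%E.
  by apply: nneseries_lim_ge => *; exact: s0.
have total0 : (0 <= \sum_(0 <= k <oo) s k)%E by apply: nneseries_ge0 => *; exact: s0.
have sE k : s k = (fine (s k))%:E.
  rewrite fineK // ge0_fin_numE // (le_lt_trans _ sfin) // (le_trans _ (partial k.+1)) //.
  by rewrite big_nat_recr //= leeDr // sume_ge0.
exists (fun k => fine (s k)); first split=> [k|].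
- by rewrite fine_ge0.
- exists (fine (\sum_(0 <= k <oo) s k)%E) => n.
  rewrite -lee_fin fineK ?ge0_fin_numE // (le_trans _ (partial n)) //.
  rewrite big_mkord -sumEFin le_eqVlt; apply/orP; left; apply/eqP.
  by apply: eq_bigr => k _; rewrite -sE.
by move=> k z Kz; rewrite -lee_fin -sE; exact: s_ub.
Qed.

Lemma uniform_cvg_modulus {V : normedModType R[i]} (U : set (Cplx R))
    (F : nat -> Cplx R -> V) (f : Cplx R -> V) :
  (forall e : R, 0 < e -> exists m, forall n z, (m <= n)%N -> U z -> modulus (f z - F n z) < e) ->
  {uniform U, F @ \oo --> f}.
Proof.
move=> h P /uniform_nbhs[E [+ EP]].
rewrite -entourage_ballE => -[e /= e0 eE].
have eR : e = (complex.Re e)%:C%C by rewrite RRe_real // gtr0_real.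
have [m hm] : exists m, forall n z, (m <= n)%N -> U z -> modulus (f z - F n z) < complex.Re e.
  by apply: h; rewrite eR ltcR in e0.
exists m => // n mn /=; apply: EP => z Uz /=; apply: eE => /=.
by rewrite -ball_normE /= norm_modulus eR ltcR hm.
Qed.

End Sequences.

Section Products.
Context {R : realType} {A : fdNormedAltAlgType R[i]}.
Implicit Types (f : nat -> Cplx R -> A) (z w : Cplx R).

Lemma derivable_amul (g h : Cplx R -> A) z : derivable g z 1 -> derivable h z 1 ->
  derivable (fun w => amul (g w) (h w)) z 1.
Proof.
move=> dg dh; have hc : (fun k : Cplx R => h (k *: 1 + z)) @ 0^' --> h z.
  have cont : {for z, continuous h}.
    by apply/differentiable_continuous/derivable1_diffP.
  apply/cvg_modulusP => e e0; rewrite near_withinE.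
  have [d d0 hd] := iffLR (continuous_modulusP _ _) cont e e0.
  apply/nbhs_modulusP; exists d => // k kd _ /=; apply: hd.
  by rewrite scaler1 opprD addrCA subrr addr0 -[- k]sub0r.
have [/cvg_ex[l hl] /cvg_ex[m hm]] := (dg, dh).
apply/cvg_ex; exists (amul l (h z) + amul (g z) m).
have E : (fun k : Cplx R => k^-1 *: (amul (g (k *: 1 + z)) (h (k *: 1 + z)) - amul (g z) (h z))) =
    (fun k => amul (k^-1 *: (g (k *: 1 + z) - g z)) (h (k *: 1 + z)) +
              amul (g z) (k^-1 *: (h (k *: 1 + z) - h z))).
  apply/funext => k; rewrite -ascalerAl -ascalerAr -scalerDr amulBl amulBr.
  by congr (_ *: _); rewrite addrA subrK.
suff : (fun k : Cplx R => amul (k^-1 *: (g (k *: 1 + z) - g z)) (h (k *: 1 + z)) +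
    amul (g z) (k^-1 *: (h (k *: 1 + z) - h z))) @ 0^' --> amul l (h z) + amul (g z) m.
  by rewrite -E; exact.
exact: cvgD (amul_cvg hl hc) (amul_cvg (cvg_cst (g z)) hm).
Qed.

Lemma derivable_aprod f z n : (forall k, derivable (f k) z 1) ->
  derivable (fun w => aprod (fun k => f k w) n) z 1.
Proof.
move=> df; elim: n => [|n IH] /=; first exact: derivable_cst.
exact: derivable_amul.
Qed.

Lemma ainvertible_aprod (y : nat -> A) n :
  ainvertible (aprod y n) <-> forall k, (k < n)%N -> ainvertible (y k).
Proof.
elim: n => [|n IH] /=.
  by split=> // _; exists aone; rewrite amul1l.
split=> [/ainvertible_factors[/IH h hn] k|h].
  by rewrite ltnS leq_eqVlt => /predU1P[->|/h].
by apply: ainvertibleM; [apply/IH => k kn; apply: h; rewrite ltnS ltnW|exact: h].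
Qed.

(** If [c'] inverts [c], then c' x is close to 1, hence invertible, and so is its
    factor [x]. *)
Lemma ainvertible_open (c : A) : ainvertible c ->
  exists2 d : R, 0 < d & forall x, modulus (x - c) < d -> ainvertible x.
Proof.
move=> [c' cc']; have [d d0 hd] := @ainvertible_near1 R A.
have [C C0 hC] := @amul_bounded R A.
have K0 : 0 < C * modulus c' + 1 by rewrite ltr_wpDl // mulr_ge0 ?modulus_ge0 // ltW.
exists (d / (C * modulus c' + 1)); first by rewrite divr_gt0.
move=> x; rewrite ltr_pdivlMr // => xc.
suff : ainvertible (amul c' x) by case/ainvertible_factors.
apply: hd; rewrite -cc'.2 -amulBr (le_lt_trans (hC _ _)) // (le_lt_trans _ xc) //.
by rewrite [leRHS]mulrC ler_wpM2r ?modulus_ge0 // lerDl.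
Qed.

(** From x' - 1 = - (x - 1) x' follows |x'| <= |x'| / 2 + |1|, that is
    |x'| <= 2 |1|, which is put back into the same identity. *)
Lemma inverse_dist_one_le (C : R) (x x' : A) : 0 < C ->
  (forall x y : A, modulus (amul x y) <= C * modulus x * modulus y) ->
  inverse_pair x x' -> C * modulus (x - aone) <= 1 / 2 ->
  modulus (x' - aone) <= 2 * C * modulus (aone : A) * modulus (x - aone).
Proof.
move=> C0 hC xx' small.
have e : x' - aone = - amul (x - aone) x'.
  by rewrite amulBl amul1l xx'.1 opprB.
have h1 : modulus (x' - aone) <= C * modulus (x - aone) * modulus x'.
  by rewrite e modulusN.
have h2 : modulus x' <= modulus (x' - aone) + modulus (aone : A) by exact: modulus_le_dist.
have h3 : C * modulus (x - aone) * modulus x' <= 1 / 2 * modulus x'.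
  by rewrite ler_wpM2r ?modulus_ge0.
rewrite (le_trans h1) //.
rewrite (_ : 2 * C * _ * _ = C * modulus (x - aone) * (2 * modulus (aone : A)));
  last by ring.
by rewrite ler_wpM2l ?mulr_ge0 ?modulus_ge0 ?(ltW C0) //; lra.
Qed.

(** The inverses Q (n + 1) = y_n^-1 Q n of the partial products satisfy the same
    kind of recursion as the products. From some rank on, y_n^-1 - 1 is of the order
    of y_n - 1, so [Q] converges; its limit inverts [l]. *)
Lemma limit_ainvertible (y : nat -> A) (a : nat -> R) (T : R) (l : A) :
  (forall k, 0 <= a k) -> (forall n, \sum_(k < n) a k <= T) ->
  (forall k, modulus (y k - aone) <= a k) ->
  (fun n => aprod y n) @ \oo --> l -> (forall k, ainvertible (y k)) -> ainvertible l.
Proof.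
move=> a0 aT ya yl yinv; have [C C0 hC] := @amul_bounded R A.
have /choice[y' yy'] k : exists y', inverse_pair (y k) y' by case: (yinv k) => y' ?; exists y'.
pose Q := fix Q n := if n is m.+1 then amul (y' m) (Q m) else aone.
have PQ n : inverse_pair (aprod y n) (Q n).
  elim: n => [|n IH] /=; first by split; rewrite amul1l.
  exact: inverse_pairM.
have [N hN] : exists N, forall k, (N <= k)%N -> C * a k <= 1 / 2.
  have a_cvg0 : a @ \oo --> (0 : R).
    apply: cvg_series_cvg_0; apply: nondecreasing_is_cvgn.
      by move=> m n mn; apply: nondecreasing_series => // k _ _; exact: a0.
    by exists T => _ [n _ <-]; rewrite seriesEord; exact: aT.
  have C2 : 0 < 1 / 2 / C by rewrite !divr_gt0.
  have [N _ hN] := iffLR (cvgrPdist_le _ _) a_cvg0 _ C2.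
  exists N => k /hN /=; rewrite sub0r normrN ger0_norm // ler_pdivlMr //.
  by rewrite mulrC.
pose K := C * (2 * C * modulus (aone : A)).
have K0 : 0 <= K by rewrite !mulr_ge0 ?modulus_ge0 // ltW.
have [t t0 ht] : exists2 t : nat -> R, (forall e, 0 < e -> exists m, t m < e) &
    forall m n, (m <= n)%N -> modulus (Q (n + N)%N - Q (m + N)%N) <= t m.
  have [||| t t0 ht] := @small_increments_cauchy R (fun k => K * a (k + N)%N) (K * T) (modulus (Q N)).
  - by move=> k; rewrite mulr_ge0.
  - move=> n; rewrite -mulr_sumr ler_wpM2l // (le_trans _ (aT (N + n)%N)) //.
    rewrite big_split_ord /= ler_wpDl ?sumr_ge0 //.
    by apply: ler_sum => k _; rewrite /= addnC.
  - exact: modulus_ge0.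
  exists t => //; apply: (ht A (fun n => Q (n + N)%N)) => // n.
  rewrite addSn /= -{2}[Q _]amul1l -amulBl (le_trans (hC _ _)) //.
  rewrite ler_wpM2r ?modulus_ge0 // /K -mulrA ler_wpM2l ?(ltW C0) //.
  have h := inverse_dist_one_le C0 hC (yy' (n + N)%N).
  rewrite (le_trans (h _)) ?ler_wpM2l ?mulr_ge0 ?modulus_ge0 ?(ltW C0) //.
  by rewrite (le_trans _ (hN (n + N)%N _)) ?leq_addl // ler_wpM2l // ltW.
have /cvg_ex[q] := algebra_complete t0 ht.
rewrite -[X in X -> _]/([sequence Q (n + N)%N]_n @ \oo --> q) cvg_shiftn => hq.
have lim1 : (fun n => amul (aprod y n) (Q n)) @ \oo --> amul l q by exact: amul_cvg.
have lim2 : (fun n => amul (Q n) (aprod y n)) @ \oo --> amul q l by exact: amul_cvg.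
have one_eq (u : nat -> A) v : u @ \oo --> v -> (forall n, u n = aone) -> v = aone.
  move=> uv u1; apply/eqP; rewrite -subr_eq0; apply/eqP/modulus_eq0/le_anti.
  rewrite modulus_ge0 andbT; apply: (modulus_lim_le (m := 0) uv) => n _.
  by rewrite u1 subrr modulus0.
exists q; split; [apply: one_eq lim1 _|apply: one_eq lim2 _] => n.
  by case: (PQ n).
by case: (PQ n).
Qed.

(** The increments P_(n+1) - P_n = P_n (f_n - 1) of the partial products are small
    relative to P_n, uniformly on a compact square around [z]. *)
Lemma local_product_cauchy (G : set (Cplx R)) f z :
  open G -> normally_convergent G f -> G z ->
  exists2 r : R, 0 < r & [/\ closed_square z (2 * r) `<=` G,
    exists2 a : nat -> R, (forall k, 0 <= a k) /\ (exists T, forall n, \sum_(k < n) a k <= T) &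
      forall k w, closed_square z (2 * r) w -> modulus (f k w - aone) <= a k
  & exists2 t : nat -> R, (forall e, 0 < e -> exists m, t m < e) &
      forall w, closed_square z (2 * r) w -> forall m n, (m <= n)%N ->
        modulus (aprod (fun k => f k w) n - aprod (fun k => f k w) m) <= t m].
Proof.
move=> Go fconv Gz.
have [d d0 dG] : exists2 d : R, 0 < d & forall w, modulus (z - w) < d -> G w.
  by apply/nbhs_modulusP; rewrite openE in Go; exact: Go.
(* Points of the square of half-side 2 r are within 4 r < d of its centre. *)
pose r := d / 5; have r0 : 0 < r by rewrite divr_gt0.
have SG : closed_square z (2 * r) `<=` G.
  move=> w [wr wi]; apply: dG; rewrite modulusB (le_lt_trans (modulus_le_ReIm _)) //.
  by rewrite (le_lt_trans (lerD wr wi)) // /r; lra.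
have S0 : closed_square z (2 * r) !=set0.
  by exists z; split; rewrite subrr /= normr0 mulr_ge0 // ltW.
have [a [a0 [T aT]] fa] :=
  normally_convergent_bound fconv (@closed_square_compact _ _ _) SG S0.
exists r => //; split => //; first by exists a => //; split=> //; exists T.
have [C C0 hC] := @amul_bounded R A.
have [||| t t0 ht] := @small_increments_cauchy R (fun k => C * a k) (C * T) (modulus (aone : A)).
- by move=> k; rewrite mulr_ge0 // ltW.
- by move=> n; rewrite -mulr_sumr ler_pM2l.
- exact: modulus_ge0.
exists t => // w Sw; apply: ht => //= n.
rewrite -{2}[aprod _ n]amul1r -amulBr (le_trans (hC _ _)) // mulrAC.
by rewrite ler_wpM2r ?modulus_ge0 // ler_pM2l // fa.
Qed.

End Products.

Theorem corollary6p5 (R : realType) (A : fdNormedAltAlgType R[i])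
    (G : set (Cplx R)) (f : nat -> Cplx R -> A) (p : Cplx R) (c : A)
    (hG : domain G)
    (hf : forall k, holomorphic_on G (f k))
    (hconv : normally_convergent G f)
    (hp : G p) (hc : ainvertible c)
    (hlim : (fun n => aprod (fun k => f k p) n) @ \oo --> c) :
  exists F : Cplx R -> A,
    [/\ holomorphic_on G F,
        locally_uniformly_cvg G (fun n z => aprod (fun k => f k z) n) F
      & forall z, G z ->
          (ainvertible (F z) <-> forall k, ainvertible (f k z))].
Proof.
pose P n z := aprod (fun k => f k z) n.
pose F z := lim ((fun n => P n z) @ \oo).
have loc z := @local_product_cauchy R A G f z hG.1 hconv.
have center (z : Cplx R) (r : R) : 0 < r -> closed_square z (2 * r) z.
  by move=> r0; split; rewrite subrr /= normr0 mulr_ge0 // ltW.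
have PF z : G z -> (fun n => P n z) @ \oo --> F z.
  move=> Gz; have [r r0 [_ _ [t t0 ht]]] := loc z Gz.
  exact: (algebra_complete t0 (ht z (center z r r0))).
exists F; split.
- move=> z Gz; have [r r0 [SG _ [t t0 ht]]] := loc z Gz.
  have ballS w : modulus (w - z) <= 2 * r -> closed_square z (2 * r) w.
    by move=> wr; split; rewrite (le_trans _ wr) // ?ler_Re_modulus ?ler_Im_modulus.
  have [C C0 hC] := @coordinate_bounded R A.
  apply/derivable_coordinate => i.
  apply: (@weierstrass R (fun n w => coordinate i (P n w)) _ z r (fun m => C * t m)) => //.
  + move=> n w /ballS /SG Gw; move: i; apply/derivable_coordinate.
    by apply: derivable_aprod => k; exact: hf.
  + by move=> e e0; have [m hm] := t0 _ (divr_gt0 e0 C0); exists m; rewrite mulrC -ltr_pdivlMr.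
  + move=> m n w mn /ballS Sw; rewrite -coordinateB (le_trans (hC _ _)) // ler_pM2l //.
    exact: ht.
  + by move=> w /ballS /SG /PF; exact: coordinate_cvg.
- move=> z Gz; have [r r0 [SG _ [t t0 ht]]] := loc z Gz.
  exists (closed_square z (2 * r)).
    split=> //; apply/nbhs_modulusP; exists (2 * r); first by rewrite mulr_gt0.
    move=> w /ltW; rewrite modulusB => wr.
    by split; rewrite (le_trans _ wr) // ?ler_Re_modulus ?ler_Im_modulus.
  apply: uniform_cvg_modulus => e e0; have [m hm] := t0 _ (divr_gt0 e0 (ltr0Sn _ 1)).
  exists m => n w mn Sw; rewrite (le_lt_trans (modulus_dist_trans (P m w) _ _)) //.
  rewrite [ltRHS]splitr; apply: ltrD.
    apply: le_lt_trans hm; apply: modulus_lim_le (PF w (SG _ Sw)) _; exact: ht.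
  by rewrite modulusB (le_lt_trans _ hm) // ht.
- move=> z Gz; split=> [Finv k|finv].
    have [d d0 hd] := ainvertible_open Finv.
    have [N _ hN] := iffLR (cvg_modulusP _ _) (PF z Gz) d d0.
    have : ainvertible (P (maxn N k.+1) z).
      by apply: hd; rewrite modulusB; apply: hN; rewrite /= leq_maxl.
    by move/ainvertible_aprod; apply; rewrite leq_maxr.
  have [r r0 [_ [a [a0 [T aT]] fa] _]] := loc z Gz.
  apply: (limit_ainvertible a0 aT _ (PF z Gz) finv) => k.
  exact: fa (center z r r0).
Qed.
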